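(* Let $G$ be any directed graph and let $P(G)\subset\mathbb{CP}^{|E(G)|-1}$ be its incidence set. Then: (1) $P(G)$ is a union of finitely many linear subspaces of $\mathbb{CP}^{|E(G)|-1}$; (2) $\dim P(G)=\alpha(G)-1$; (3) $\deg P(G)=\gamma_{\alpha(G)}(G)$; (4) for every $n\geq 1$, $\gamma_n(G)$ is equal to the number of irreducible components of $P(G)$ of dimension $n-1$.
   Context: A directed graph $G$ is a pair of finite sets $V(G)$ (vertices) and $E(G)$ (edges), each edge having an initial and a terminal vertex; loops and multiple edges are allowed, and no vertex has degree $0$. A directed cycle is a sequence $v_0,x_0,v_1,\dots,v_n,x_n,v_0$ with $v_0,\dots,v_n$ pairwise distinct vertices and each $x_i$ an edge from $v_i$ to $v_{i+1}$ (indices mod $n+1$); sequences differing by a circular permutation give the same cycle. Two directed cycles are edge-disjoint if they share no edges. $\alpha(G)$ is the maximal number of pairwise edge-disjoint directed cycles in $G$. A collection of pairwise edge-disjoint directed cycles is maximal if it is not contained in a larger such collection; $\gamma_n(G)$ is the number of maximal collections of pairwise edge-disjoint directed cycles in $G$ containing exactly $n$ cycles. For a vertex $v$ let $x_1,\dots,x_m$ be the edges with initial vertex $v$ and $y_1,\dots,y_n$ the edges with terminal vertex $v$ (a loop at $v$ appears in both lists), $k_v=\max\{m,n\}$, and $\delta_{v,l}=e_l(x_1,\dots,x_m)-e_l(y_1,\dots,y_n)\in\mathbb{Z}[E(G)]$ for $1\le l\le k_v$, where $e_l$ is the $l$-th elementary symmetric polynomial ($e_l=0$ if $l$ exceeds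 the number of variables). The incidence ideal $I(G)$ is the (homogeneous) ideal of $\mathbb{Z}[E(G)]$ generated by all $\delta_{v,l}$, and the incidence set is $P(G)=\{p\in\mathbb{CP}^{|E(G)|-1}: f(p)=0\ \forall f\in I(G)\}$, where coordinates are indexed by $E(G)$. The degree of a projective algebraic set is the sum of the degrees of its top-dimensional irreducible components.
   Formalization: For a graph without directed cycles P(G) is empty and has no components, so the degree as defined would be 0 while the number of maximal collections is 1; here the empty set is given degree 1, and the degree of nonempty sets is unchanged. *)

(* Defs.v *)
From HB Require Import structures.
From mathcomp Require Import all_boot all_order all_algebra.
From mathcomp Require Import boolp classical_sets cardinality fsbigop reals.
From mathcomp Require Import complex mpoly.

Set Implicit Arguments.
Unset Strict Implicit.
Unset Printing Implicit Defensive.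

Import GRing.Theory.

Local Open Scope ring_scope.
Local Open Scope complex_scope.

Record digraph := Digraph {
  vertex : finType;
  edge : finType;
  src : edge -> vertex;
  tgt : edge -> vertex;
  no_isolated : forall v, exists x, src x = v \/ tgt x = v
}.

Arguments src {d} x.
Arguments tgt {d} x.

Section Cycles.
Variable G : digraph.

(* The sequence v_0, x_0, v_1, ..., v_n, x_n, v_0 is encoded by its edges
   x_0, ..., x_n, since v_i = src x_i. *)
Definition is_dicycle_seq (s : seq (edge G)) : bool :=
  [&& s != [::], cycle [rel x y | tgt x == src y] s & uniq (map src s)].

(* As the vertices src x_i are pairwise distinct, at most #|vertex G| edges
   can occur; the bound only serves to make the type finite. *)
Definition dicycle_seq := {s : #|vertex G|.-bseq (edge G) | is_dicycle_seq s}.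

Definition edges_of (s : dicycle_seq) : seq (edge G) := val (val s).

Definition rotation (s t : dicycle_seq) : bool :=
  edges_of t \in [seq rot i (edges_of s) | i <- iota 0 (size (edges_of s))].

(* A directed cycle is a class of sequences modulo circular permutation. *)
Definition dicycle :=
  {c : {set dicycle_seq} |
    c \in equivalence_partition rotation [set: dicycle_seq]}.

Definition cycle_edges (c : dicycle) : {set edge G} :=
  [set x | [exists s in val c, x \in edges_of s]]%SET.

Definition edge_disjoint (A : {set dicycle}) : bool :=
  [forall c in A, forall d in A,
    (c != d) ==> [disjoint cycle_edges c & cycle_edges d]].

Definition alpha : nat := \max_(A : {set dicycle} | edge_disjoint A) #|A|.

Definition gamma (n : nat) : nat :=
  #|[set A : {set dicycle} | maxset edge_disjoint A & #|A| == n]%SET|.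

End Cycles.

Section Projective.
Variables (R : realType) (N : nat).
Local Open Scope classical_set_scope.

(* CP^(N-1), as the set of lines through the origin of C^N; it is empty for
   N = 0. *)
Definition CP := {L : {vspace 'rV[R[i]]_N} | \dim L == 1%N}.

Implicit Types (X Z : set CP) (W : {vspace 'rV[R[i]]_N}).

Definition vanishes (f : {mpoly R[i][N]}) (p : CP) : Prop :=
  forall v, v \in val p -> v != 0 -> f.@[v ord0] = 0.

Definition linear_subspace W : set CP := [set p | (val p <= W)%VS].

Definition algebraic X : Prop :=
  exists S : set {mpoly R[i][N]},
    (forall f, S f -> exists d : nat, f \is d.-homog) /\
    X = [set p | forall f, S f -> vanishes f p].

Definition irreducible_set Z : Prop :=
  [/\ algebraic Z, Z !=set0 &
      forall A B, algebraic A -> algebraic B -> Z = A `|` B -> Z = A \/ Z = B].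

Definition component X Z : Prop :=
  [/\ irreducible_set Z, Z `<=` X &
      forall Z', irreducible_set Z' -> Z `<=` Z' -> Z' `<=` X -> Z' = Z].

(* There are irreducible algebraic sets Z_0, ..., Z_(n-1) contained in X and
   strictly increasing. *)
Definition has_chain X (n : nat) : Prop :=
  exists Z : nat -> set CP,
    (forall i, (i < n)%N -> irreducible_set (Z i) /\ Z i `<=` X) /\
    (forall i, (i.+1 < n)%N -> Z i `<` Z i.+1).

(* Krull dimension: the longest chain has dim X + 1 members. In particular
   the empty set has dimension -1. *)
Definition proj_dim X : int :=
  (xget 0%N [set n | has_chain X n /\ forall m, has_chain X m -> (m <= n)%N])%:Z
  - 1.

(* A general linear subspace of codimension d, cut out by d linear forms (the
   columns of A), meets Z in exactly k points; "general" means that the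
   coefficients of the forms avoid the zero locus of some nonzero
   polynomial F. *)
Definition general_section Z (d k : nat) : Prop :=
  exists2 F : {mpoly R[i][N * d]}, F != 0 &
    forall A : 'M[R[i]]_(N, d), F.@[mxvec A ord0] != 0 ->
      ([set p | Z p /\ forall v, v \in val p -> v *m A = 0] #= `I_k)%card.

Definition degree_irr Z : nat :=
  xget 0%N [set k | exists2 d : nat, proj_dim Z = d%:Z & general_section Z d k].

(* The empty set is the linear subspace of dimension -1; like every linear
   subspace, it is given degree 1. It has no irreducible component in the
   sense of [component], so that the sum would give 0. *)
Definition degree X : nat :=
  if pselect (X = set0) then 1%N else
  \sum_(Z \in [set Z | component X Z /\ proj_dim Z = proj_dim X]) degree_irr Z.

End Projective.

(* The ideal generated by S. *)
Definition ideal_gen (A : comNzRingType) (S : set A) : set A :=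
  [set f | exists (n : nat) (a g : 'I_n -> A),
     (forall i, S (g i)) /\ f = \sum_(i < n) a i * g i]%classic.

Section Incidence.
Variable G : digraph.
Local Notation N := #|edge G|.

(* Z[E(G)], whose variables are indexed by 'I_N through [enum_rank]. *)
Local Notation ZE := {mpoly int[N]}.

Definition edge_var (x : edge G) : ZE := 'X_(enum_rank x).

(* e_l evaluated at the variables of the edges in A; [mesym] vanishes when l
   exceeds the number of variables. *)
Definition elem_sym (A : {set edge G}) (l : nat) : ZE :=
  mesym #|A| int l \mPo map_tuple edge_var (enum_tuple A).

Definition out_edges (v : vertex G) : {set edge G} :=
  [set x | src x == v]%SET.
Definition in_edges (v : vertex G) : {set edge G} :=
  [set x | tgt x == v]%SET.

Definition max_degree (v : vertex G) : nat :=
  maxn #|out_edges v| #|in_edges v|.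

Definition delta (v : vertex G) (l : nat) : ZE :=
  elem_sym (out_edges v) l - elem_sym (in_edges v) l.

Definition incidence_ideal : set ZE :=
  ideal_gen [set f | exists (v : vertex G) (l : nat),
                       (1 <= l <= max_degree v)%N /\ f = delta v l]%classic.

Definition incidence_set (R : realType) : set (CP R N) :=
  [set p | forall f, incidence_ideal f ->
             vanishes (map_mpoly intr f) p]%classic.

End Incidence.

Arguments incidence_set G R p : clear implicits.

(* Main.v *)
Require Import Defs.
From HB Require Import structures.
From mathcomp Require Import all_boot all_order all_algebra.
From mathcomp Require Import boolp classical_sets cardinality fsbigop reals.
From mathcomp Require Import complex mpoly.

(* A point v of the affine cone over P(G) has, at every vertex, the same
   multiset of nonzero values on the outgoing and on the incoming edges; so
   each set of edges on which v takes a given nonzero value is balanced, and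
   splits into edge-disjoint directed cycles. Hence the cone is the union of
   the spans of the indicator vectors of the cycles in A, for A a collection of
   pairwise edge-disjoint cycles. Such a span has dimension #|A|, and inclusion
   of spans is inclusion of collections, so the maximal collections give the
   irreducible components.

   The Krull dimension of a union of linear subspaces is bounded as follows:
   homogeneous polynomials of one degree that cut out the steps of a chain of
   irreducible sets are algebraically independent on the largest of them, and
   n polynomials in m < n variables are algebraically dependent because the
   forms of degree d in n variables outnumber those of degree d e in m
   variables for large d. *)

Set Implicit Arguments.
Unset Strict Implicit.
Unset Printing Implicit Defensive.

Import GRing.Theory Num.Theory.

Local Open Scope ring_scope.

(** * Forms and algebraic dependence *)

Section MPoly.
Variable K : fieldType.

(** [muni] only regroups monomials: [m] is determined by its last exponent together with the
    remaining ones, collected in [r m], so the coefficient of [p] at [m] survives as a coefficient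
    of [muni p]. *)
Lemma muni_eq0 n (p : {mpoly K[n.+1]}) : (muni p == 0) = (p == 0).
Proof.
apply/eqP/eqP=> [p0|->]; last exact: muni0.
apply/mpolyP=> m; rewrite mcoeff0; apply/eqP; apply: contraT.
rewrite -mcoeff_msupp => mp.
set r := fun m : 'X_{1..n.+1} => [multinom m (widen_ord (leqnSn n) i) | i < n].
move: (congr1 (fun q : {poly {mpoly K[n]}} => (q`_(m ord_max))@_(r m)) p0).
rewrite muniE coef0 mcoeff0 coef_sum raddf_sum /= (bigD1_seq m) ?msupp_uniq //=.
rewrite coefZ coefXn eqxx mulr1 mcoeffZ mcoeffX eqxx mulr1.
rewrite big1 ?addr0; first by move=> h; rewrite mcoeff_msupp h eqxx in mp.
move=> k nkm; rewrite coefZ coefXn.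
have [ek|_] := eqVneq (m ord_max) (k ord_max); last by rewrite mulr0 mcoeff0.
rewrite mulr1 mcoeffZ mcoeffX.
case: eqP => [rk|]; last by rewrite mulr0.
case/eqP: nkm; apply/mnmP=> i.
have [ei|ei] := ltnP i n; last first.
  have -> : i = ord_max by apply/val_inj/eqP; rewrite eqn_leq ei -ltnS ltn_ord.
  exact: esym.
move/mnmP/(_ (Ordinal ei)): rk; rewrite !mnmE.
by have -> : widen_ord (leqnSn n) (Ordinal ei) = i by apply/val_inj.
Qed.

(** The point on the right has last coordinate [t] and its other coordinates from [v]; evaluation
    thus proceeds one variable at a time. *)
Lemma horner_muni n (p : {mpoly K[n.+1]}) (v : 'I_n -> K) (t : K) :
  (map_poly (meval v) (muni p)).[t]
    = p.@[fun i => oapp v t (unlift ord_max i)].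
Proof.
rewrite muniE mevalE rmorph_sum /= horner_sum; apply: eq_bigr => m _.
rewrite map_polyZ /= map_polyXn hornerZ hornerXn mevalZ mevalX big_ord_recr /=.
rewrite unlift_none /= mulrA; congr (_ * _ * _); apply: eq_bigr => i _.
have -> : widen_ord (leqnSn n) i = lift ord_max i.
  by apply/val_inj; rewrite /= /bump leqNgt ltn_ord.
by rewrite mnmE liftK; congr (_ ^+ m _); apply/val_inj; rewrite /= /bump leqNgt ltn_ord.
Qed.

Lemma dhomog_meval_scale n d (f : {mpoly K[n]}) (c : K) (v : 'I_n -> K) :
  f \is d.-homog -> f.@[fun i => c * v i] = c ^+ d * f.@[v].
Proof.
move=> /dhomogP hf; rewrite !mevalE mulr_sumr; apply: eq_big_seq => m /hf <-.
rewrite mulrCA; congr (_ * _); rewrite /= mdegE -prodrXr -big_split /=.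
by apply: eq_bigr => i _; rewrite exprMn.
Qed.

Lemma dhomog_comp_mpoly n k d e (F : {mpoly K[n]}) (f : n.-tuple {mpoly K[k]}) :
  F \is d.-homog -> (forall i, tnth f i \is e.-homog) ->
  F \mPo f \is (d * e).-homog.
Proof.
move=> /dhomogP hF hf; rewrite comp_mpolyEX big_seq rpred_sum // => m /hF <-.
rewrite rpredZ // comp_mpolyX /= mdegE big_distrl /=.
elim/big_rec2: _ => [|i d' q _ hq]; first exact: dhomog1.
by apply: dhomogM => //; rewrite mulnC; apply: dhomogMn.
Qed.

End MPoly.

(** By induction, the first variables can be given values at which the leading coefficient in the
    last variable survives; a nonzero univariate polynomial remains. *)
Lemma meval_neq0 (K : numFieldType) n (p : {mpoly K[n]}) :
  p != 0 -> exists v : 'I_n -> K, p.@[v] != 0.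
Proof.
elim: n p => [|n IHn] p p0.
  exists (fun=> 0); rewrite -(mpolyKC p) mevalC.
  by apply: contraNneq p0 => p0; rewrite -(mpolyKC p) p0 mpolyC0.
have [|v hv] := IHn (lead_coef (muni p)); first by rewrite lead_coef_eq0 muni_eq0.
set q := map_poly (meval v) (muni p).
have q0 : q != 0.
  apply: contraNneq hv => /(congr1 (fun r : {poly K} => r`_(size (muni p)).-1)).
  by rewrite coef_map coef0 /= => ->.
have [t ht] : exists t, ~~ root q t.
  (* These are [size q] distinct elements, one more than the degree of [q], so not all are roots. *)
  pose s := [seq (i%:R : K) | i <- iota 0 (size q)].
  have [/allP sr|/allPn[t _ ht]] := boolP (all (root q) s); last by exists t.
  have : (size s < size q)%N.
    apply: max_poly_roots => //; first exact/allP.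
    by rewrite map_inj_uniq ?iota_uniq // => i j /eqP; rewrite eqr_nat => /eqP.
  by rewrite size_map size_iota ltnn.
by exists (fun i => oapp v t (unlift ord_max i)); rewrite -horner_muni.
Qed.

(** As functions of [d] the two sides are polynomials of degrees at most [m] and exactly [n]. They
    count the monomials of degree [d * e] in [m.+1] variables and of degree [d] in [n.+1]
    variables. *)
Lemma bin_scaled_lt e m n : (m < n)%N ->
  exists d, ('C(d * e + m, d * e) < 'C(d + n, d))%N.
Proof.
(* With this [c], the upper bound [((c + 1) * (e + m)) ^ m] for the left side, multiplied by [m.+1]
   factorial, equals [(c + 1) ^ m * c], which is below the lower bound [(c + 1) ^ m.+1] for the
   right side. *)
move=> mn; pose c := ((e + m) ^ m * m.+1`!)%N; exists c.
have bin_le N k : ('C(N, k) <= N ^ k)%N.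
  apply: leq_trans (leq_pmulr _ (fact_gt0 k)) _; rewrite bin_ffact.
  elim: k N => // k IHk N; rewrite ffactnS expnS leq_mul //.
  by apply: leq_trans (IHk _) _; case: k {IHk} => // k; rewrite leq_exp2r ?leq_pred.
have le_ffact k : (c.+1 ^ k <= (c + k) ^_ k)%N.
  by elim: k => // k IHk; rewrite addnS ffactnS expnS leq_mul // ltnS leq_addr.
apply: (@leq_trans 'C(c + m.+1, c)); last first.
  by rewrite leq_bin2l // leq_add2l.
rewrite -[X in ('C(_, X) < _)%N](addnK m) bin_sub ?leq_addl //.
rewrite -[X in (_ < 'C(_, X))%N](addnK m.+1) bin_sub ?leq_addl //.
rewrite -(ltn_pmul2r (fact_gt0 m.+1)) bin_ffact; apply: leq_trans (le_ffact _).
apply: (@leq_ltn_trans ((c.+1 * (e + m)) ^ m * m.+1`!)); last first.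
  by rewrite expnMn -mulnA -/c expnSr ltn_pmul2l ?expn_gt0.
rewrite leq_mul2r; apply/orP; right; apply: leq_trans (bin_le _ _) _.
case: m {mn bin_le le_ffact} @c => // m c; rewrite leq_exp2r //.
by rewrite mulnDr leq_add ?leq_mul // leq_pmull.
Qed.

(** Substituting [f] is a linear map from forms of degree [d] in [n] variables to forms of degree
    [d * e] in [m] variables; for a suitable [d] the target has smaller dimension, so the map has a
    nonzero kernel. *)
Lemma homog_algebraic_dependence (K : fieldType) m n e
    (f : n.-tuple {mpoly K[m]}) :
  (0 < m < n)%N -> (forall i, tnth f i \is e.-homog) ->
  exists d (F : {mpoly K[n]}), [/\ F != 0, F \is d.-homog & F \mPo f = 0].
Proof.
case: m n f => // m [//|n] f /= mn hf.
have [d lt_bin] := bin_scaled_lt e (mn : (m < n)%N); exists d; apply: contrapT => noF.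
pose X := vbasis {: dhomog n.+1 K d}.
pose phi (p : dhomog n.+1 K d) : dhomog m.+1 K (d * e) :=
  DHomog (dhomog_comp_mpoly (dhomog_is_dhomog p) hf).
pose Y := map_tuple phi X.
(* If no relation existed, the images of a basis would be free in a space of smaller dimension. *)
suff : free Y.
  rewrite /free size_tuple => /eqP dimY.
  have := dimvS (subvf <<Y>>%VS); rewrite dimY !dimvf /dim /= leqNgt.
  by rewrite lt_bin.
apply/freeP => k kY.
pose p := \sum_(i < \dim {: dhomog n.+1 K d}) k i *: X`_i.
have p_eq0 : p = 0.
  apply: contrapT => /eqP p0; apply: noF; exists (val p); split => //.
    exact: dhomog_is_dhomog.
  have := congr1 val kY; rewrite /p !raddf_sum /=; apply: etrans.
  apply: eq_bigr => i _.
  by rewrite linearZ /= (nth_map 0) ?size_tuple.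
by have /freeP/(_ k p_eq0) := basis_free (vbasisP {: dhomog n.+1 K d}).
Qed.

(** * Splitting a polynomial along one variable *)

Section MonomialRestriction.
Variables (K : fieldType) (n : nat).

Definition mrestrict (S : pred 'X_{1..n}) (F : {mpoly K[n]}) : {mpoly K[n]} :=
  \sum_(m <- msupp F | S m) F@_m *: 'X_[m].

Lemma mcoeff_mrestrict S F m : (mrestrict S F)@_m = if S m then F@_m else 0.
Proof.
rewrite /mrestrict raddf_sum /=.
under eq_bigr do rewrite mcoeffZ mcoeffX.
have [mF|mF] := boolP (m \in msupp F); last first.
  rewrite (memN_msupp_eq0 mF) if_same big_seq_cond big1 // => k /andP[kF _].
  by case: eqP kF mF => [-> ->|_ _ _]; rewrite ?mulr0.
case: ifP => Sm.
  rewrite big_mkcond (bigD1_seq m) ?msupp_uniq //= Sm eqxx mulr1.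
  by rewrite big1 ?addr0 // => k /negPf->; rewrite mulr0 if_same.
by rewrite big1 // => k Sk; case: eqP Sk => [->|_ _]; rewrite ?Sm // mulr0.
Qed.

(** [G] collects the monomials divisible by ['X_k], each divided by it. The coefficient formula
    controls the degree of [G] and the variables that occur in it. *)
Lemma mpoly_split_var (F : {mpoly K[n]}) (k : 'I_n) :
  exists G : {mpoly K[n]}, F = mrestrict (fun m => m k == 0%N) F + 'X_k * G /\
    forall m, G@_m = F@_(m + U_(k))%MM.
Proof.
exists (\sum_(m <- msupp F | m k != 0%N) F@_m *: 'X_[m - U_(k)]).
have FE : F = mrestrict (fun m => m k == 0%N) F +
    'X_k * \sum_(m <- msupp F | m k != 0%N) F@_m *: 'X_[m - U_(k)].
  rewrite [LHS]mpolyE (bigID (fun m : 'X_{1..n} => m k == 0%N)) /=.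
  congr (_ + _); rewrite mulr_sumr; apply: eq_bigr => m mk.
  by rewrite -scalerAr -mpolyXD addmC submK // lep1mP.
split=> // m; rewrite [in RHS]FE mcoeffD mcoeff_mrestrict mnmDE mnm1E eqxx.
by rewrite addn1 /= add0r mulrC [(m + _)%MM]addmC mcoeffMX.
Qed.

End MonomialRestriction.

(** * Algebraic independence along a chain of cones *)

Section ChainIndependence.
Variables (K : fieldType) (N n e : nat) (f : n.-tuple {mpoly K[N]}).
Variable Y : nat -> 'rV[K]_N -> Prop.

Local Notation vanishes_on g k := (forall v, Y k v -> g.@[v ord0] = 0).

Hypothesis fhomog : forall i, tnth f i \is e.-homog.
Hypothesis Y0 : Y 0 0.
Hypothesis Ysub : forall k v, (k < n)%N -> Y k v -> Y k.+1 v.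
Hypothesis f0 : forall k : 'I_n, vanishes_on (tnth f k) k.
Hypothesis fS : forall k : 'I_n, ~ vanishes_on (tnth f k) k.+1.
Hypothesis Yprime : forall k d d' g h, (k < n)%N ->
  g \is d.-homog -> h \is d'.-homog ->
  vanishes_on (g * h) k.+1 -> vanishes_on g k.+1 \/ vanishes_on h k.+1.

(* Write F = F0 + 'X_k * G with F0 free of 'X_k. As f_k vanishes on Y k, so does
   F0(f), whence F0 = 0; then f_k * G(f) vanishes on Y k.+1, where f_k does
   not, so that G(f) does, and G has smaller degree. *)
Let indep k (F : {mpoly K[n]}) d : (k <= n)%N ->
  F \is d.-homog ->
  (forall m (i : 'I_n), F@_m != 0 -> (k <= i)%N -> m i = 0%N) ->
  vanishes_on (F \mPo f) k -> F = 0.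
Proof.
elim: k F d => [|k IHk] F d kn Fd Fk FY.
  (* For [k = 0] no variable is left, so [F] is a constant, which the point [0] of [Y 0] forces to
     be zero. *)
  have FE : F = (F@_0%MM)%:MP.
    apply/mpolyP=> m; rewrite mcoeffC eq_sym.
    have [->|m0] := eqVneq m 0%MM; first by rewrite mulr1.
    rewrite mulr0; apply: contraNeq m0 => Fm.
    by apply/eqP/mnmP=> i; rewrite mnm0E (Fk _ i Fm).
  by move: (FY _ Y0); rewrite FE comp_mpolyC mevalC => ->.
pose ko := Ordinal kn.
have coef_deg d' H : H \is d'.-homog <-> forall m, H@_m != 0 -> mdeg m = d'.
  split=> [/dhomogP hH m|hH]; first by rewrite -mcoeff_msupp => /hH.
  by apply/dhomogP=> m; rewrite mcoeff_msupp => /hH.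
(* The inner induction on the degree handles [G], the outer one on [k] handles [F0]. *)
elim/ltn_ind: d F Fd Fk FY => d IHd F /coef_deg Fd Fk FY.
have [G [FE GE]] := mpoly_split_var F ko; set F0 := mrestrict _ _ in FE.
have F0E m : F0@_m != 0 -> F@_m != 0 /\ m ko = 0%N.
  by rewrite mcoeff_mrestrict; case: (m ko =P 0%N) => //; rewrite eqxx.
have FfE v : (F \mPo f).@[v] = (F0 \mPo f).@[v] + (tnth f ko * (G \mPo f)).@[v].
  by rewrite [in LHS]FE rmorphD rmorphM /= comp_mpolyXU mevalD -tnth_nth.
have F0_eq0 : F0 = 0.
  apply: (IHk _ d (ltnW kn)); first by apply/coef_deg=> m /F0E[/Fd].
    move=> m i /F0E[Fm mk]; rewrite leq_eqVlt => /predU1P[ki|]; last exact: Fk.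
    by rewrite -mk; congr (m _); apply/val_inj.
  move=> v Yv; have := FY v (Ysub kn Yv).
  by rewrite FfE mevalM (f0 (k := ko)) // mul0r addr0.
suff G0 : G = 0 by rewrite FE F0_eq0 G0 mulr0 addr0.
have Gd m : G@_m != 0 -> (mdeg m).+1 = d.
  by rewrite GE => /Fd; rewrite mdegD mdeg1 addn1.
case: d IHd Fd Gd => [|d] IHd Fd Gd.
  by apply/mpolyP=> m; rewrite mcoeff0; apply: contraTeq isT => /Gd.
apply: (IHd d) => //.
- by apply/coef_deg=> m /Gd[].
- move=> m i; rewrite GE => Gm ki; have := Fk _ i Gm ki.
  by rewrite mnmDE => /eqP; rewrite addn_eq0 => /andP[/eqP].
have Gh : G \is d.-homog by apply/coef_deg=> m /Gd[].
have fG v : Y k.+1 v -> (tnth f ko * (G \mPo f)).@[v ord0] = 0.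
  by move=> Yv; have := FY v Yv; rewrite FfE F0_eq0 comp_mpoly0 meval0 add0r.
by case: (Yprime kn (fhomog ko) (dhomog_comp_mpoly Gh fhomog) fG) => // /(fS (k := ko)).
Qed.

Lemma chain_algebraic_independence (F : {mpoly K[n]}) d :
  F \is d.-homog -> vanishes_on (F \mPo f) n -> F = 0.
Proof.
move=> Fd; apply: indep Fd _ => // m i _ ni.
by have := leq_trans (ltn_ord i) ni; rewrite ltnn.
Qed.

End ChainIndependence.

(** * Linear subspaces of projective space *)

Section LinearForms.
Variables (K : fieldType) (N : nat).
Implicit Types W : {vspace 'rV[K]_N}.

Definition linear_form (c : 'cV[K]_N) : {mpoly K[N]} := \sum_i c i 0 *: 'X_i.

Lemma linear_form_homog c : linear_form c \is 1.-homog.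
Proof. by apply: rpred_sum => i _; rewrite rpredZ // dhomogX /= mdeg1. Qed.

Lemma meval_linear_form c (v : 'rV_N) : (linear_form c).@[v ord0] = (v *m c) 0 0.
Proof.
rewrite rmorph_sum mxE; apply: eq_bigr => i _ /=.
by rewrite mevalZ mevalXU mulrC.
Qed.

(** The rows of [B] form a basis, so [u *m B] parametrizes [W] bijectively by row vectors [u]. *)
Lemma vspace_matrix W :
  exists B : 'M[K]_(\dim W, N), row_free B /\ forall v, (v \in W) = (v <= B)%MS.
Proof.
pose B : 'M[K]_(\dim W, N) := \matrix_i (vbasis W)`_i; exists B.
have mulB (u : 'rV_(\dim W)) : u *m B = \sum_i u 0 i *: (vbasis W)`_i.
  by rewrite mulmx_sum_row; apply: eq_bigr => i _; rewrite rowK.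
split.
  apply: inj_row_free => u; rewrite mulB => u0; apply/rowP=> i; rewrite mxE.
  by have /freeP/(_ (u 0) u0) := basis_free (vbasisP W).
move=> v; apply/idP/submxP=> [/coord_vbasis ->|[u ->]].
  exists (\row_i coord (vbasis W) i v); rewrite mulB.
  by apply: eq_bigr => i _; rewrite mxE.
rewrite mulB; apply: rpred_sum => i _; apply: rpredZ; apply: vbasis_mem.
by rewrite mem_nth // size_tuple.
Qed.

Lemma vspace_kernel W :
  exists C : 'M[K]_N, forall v, (v \in W) = (v *m C == 0).
Proof.
have [B [_ WB]] := vspace_matrix W.
by exists (cokermx B) => v; rewrite WB submxE.
Qed.

(** The columns of the kernel matrix are equations of [W], and one of them fails at [v]. *)
Lemma linear_form_separates W v : v \notin W ->
  exists c, (forall w, w \in W -> (linear_form c).@[w ord0] = 0) /\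
            (linear_form c).@[v ord0] != 0.
Proof.
have [C WC] := vspace_kernel W; rewrite WC => /eqP vC.
have [j hj] : exists j, (v *m C) 0 j != 0.
  apply/existsP; apply: contraT; rewrite negb_exists => /forallP h.
  by case: vC; apply/rowP=> j; rewrite [RHS]mxE; apply/eqP; rewrite -[_ == _]negbK h.
have mulE w : (w *m col j C) 0 0 = (w *m C) 0 j.
  by rewrite colE mulmxA -colE mxE.
exists (col j C); split=> [w|]; rewrite meval_linear_form mulE //.
by rewrite WC => /eqP->; rewrite mxE.
Qed.

End LinearForms.

Section SubstRows.
Variables (K : fieldType) (N m : nat) (B : 'M[K]_(m, N)).

(** The restriction of [f] to the row space of [B], written in the coordinates [u] of [u *m B]. *)
Definition subst_rows (f : {mpoly K[N]}) : {mpoly K[m]} :=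
  f \mPo [tuple linear_form (col i B) | i < N].

Lemma meval_subst_rows f (u : 'rV_m) :
  (subst_rows f).@[u ord0] = f.@[(u *m B) ord0].
Proof.
rewrite comp_mpoly_meval; apply: meval_eq => i.
by rewrite tnth_mktuple meval_linear_form colE mulmxA -colE mxE.
Qed.

Lemma subst_rows_homog d f : f \is d.-homog -> subst_rows f \is d.-homog.
Proof.
move=> fd; rewrite -[d]muln1; apply: dhomog_comp_mpoly => // i.
by rewrite tnth_mktuple linear_form_homog.
Qed.

End SubstRows.

(** * Projective points, affine cones and irreducible sets *)

Section Projective.
Variables (R : realType) (N : nat).
Local Open Scope classical_set_scope.
Local Notation K := R[i].
Local Notation CP := (CP R N).
Implicit Types (p : CP) (X Z : set CP) (W : {vspace 'rV[K]_N}) (v : 'rV[K]_N).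
Implicit Types (f g h : {mpoly K[N]}).

Lemma point_of v : v != 0 -> exists p, val p = <[v]>%VS.
Proof.
move=> v0; have dv : \dim <[v]> == 1%N by rewrite dim_vline v0.
by exists (exist (fun L : {vspace _} => \dim L == 1%N) _ dv).
Qed.

Lemma point_gen p : exists2 v, v != 0 & val p = <[v]>%VS.
Proof.
have /eqP p1 := valP p; exists (vpick (val p)).
  by rewrite vpick0 -dimv_eq0 p1.
apply/esym/eqP; rewrite eqEdim -memvE memv_pick p1 dim_vline vpick0 -dimv_eq0.
by rewrite p1.
Qed.

Lemma vanishes_line d f p v : f \is d.-homog -> v != 0 -> val p = <[v]>%VS ->
  vanishes f p <-> f.@[v ord0] = 0.
Proof.
move=> fd v0 pv; split=> [|fv w]; first by apply=> //; rewrite pv memv_line.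
rewrite pv => /vlineP[c ->] _.
rewrite (@meval_eq _ _ _ (fun i => c * v ord0 i)) => [|i]; last by rewrite mxE.
by rewrite (dhomog_meval_scale _ _ fd) fv mulr0.
Qed.

Lemma linear_subspace_line W p v : val p = <[v]>%VS ->
  linear_subspace W p <-> v \in W.
Proof. by rewrite /linear_subspace /= => ->; rewrite -memvE. Qed.

Lemma linear_subspace_sub W W' :
  linear_subspace (R := R) W `<=` linear_subspace W' <-> (W <= W')%VS.
Proof.
split=> [sWW|sWW p /=]; last by move=> /subv_trans; apply.
apply/subvP=> v vW; have [->|v0] := eqVneq v 0; first exact: mem0v.
have [p pv] := point_of v0.
by apply/(linear_subspace_line _ pv)/sWW/(linear_subspace_line _ pv).
Qed.

Lemma linear_subspace_inj : injective (@linear_subspace R N).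
Proof.
move=> W W' eW; apply/eqP; rewrite eqEsubv.
by apply/andP; split; apply/linear_subspace_sub; rewrite eW.
Qed.

Lemma linear_subspace0 : linear_subspace (R := R) (0 : {vspace 'rV[K]_N}) = set0.
Proof.
rewrite -subset0 => p; have [v v0 pv] := point_gen p.
by move=> /(linear_subspace_line _ pv); rewrite memv0 (negPf v0).
Qed.

Lemma linear_subspace_neq0 W : W != 0%VS -> linear_subspace (R := R) W !=set0.
Proof.
rewrite -vpick0 => W0; have [p pv] := point_of W0.
by exists p; apply/(linear_subspace_line _ pv)/memv_pick.
Qed.

(** The affine cone over [Z]; it contains [0] exactly when [Z] is nonempty. *)
Definition cone Z v : Prop := exists2 p, Z p & v \in val p.

Lemma cone_vanishes d f Z : f \is d.-homog ->
  (forall p, Z p -> vanishes f p) <-> (forall v, cone Z v -> f.@[v ord0] = 0).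
Proof.
move=> fd; split=> [fZ v [p Zp vp]|fZ p Zp v vp _]; last by apply: fZ; exists p.
have [u u0 pu] := point_gen p; move: vp; rewrite pu => /vlineP[c ->].
rewrite (@meval_eq _ _ _ (fun i => c * u ord0 i)) => [|i]; last by rewrite mxE.
rewrite (dhomog_meval_scale _ _ fd).
by move: (fZ p Zp) => /(vanishes_line fd u0 pu) ->; rewrite mulr0.
Qed.

Lemma algebraic_hypersurface Z d g : g \is d.-homog -> algebraic Z ->
  algebraic (Z `&` [set p | vanishes g p]).
Proof.
move=> gd [S [Sh ->]]; exists (S `|` [set g]); split=> [f [/Sh //|->]|].
  by exists d.
apply/seteqP; split=> p /=.
  by case=> Sp gp f [/Sp|->].
by move=> Sp; split=> [f Sf|]; apply: Sp; [left|right].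
Qed.

(** [Z] is the union of its intersections with the hypersurfaces of [g] and of [h], so
    irreducibility makes one of these all of [Z]. *)
Lemma irreducible_prime Z d d' g h : irreducible_set Z ->
  g \is d.-homog -> h \is d'.-homog ->
  (forall v, cone Z v -> (g * h).@[v ord0] = 0) ->
  (forall v, cone Z v -> g.@[v ord0] = 0) \/
  (forall v, cone Z v -> h.@[v ord0] = 0).
Proof.
move=> [algZ _ irrZ] gd hd ghZ.
have [] := irrZ _ _ (algebraic_hypersurface gd algZ) (algebraic_hypersurface hd algZ).
- apply/seteqP; split=> [p Zp|p [[]|[]]//]; have [v v0 pv] := point_gen p.
  have /ghZ : cone Z v by exists p; rewrite // pv memv_line.
  rewrite mevalM => /eqP; rewrite mulf_eq0 => /orP[]/eqP.
    by move=> /(vanishes_line gd v0 pv); left.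
  by move=> /(vanishes_line hd v0 pv); right.
- by move=> ZE; left; apply/(cone_vanishes _ gd) => p; rewrite ZE => -[].
- by move=> ZE; right; apply/(cone_vanishes _ hd) => p; rewrite ZE => -[].
Qed.

Lemma algebraic_linear W : algebraic (linear_subspace (R := R) W).
Proof.
have [C WC] := vspace_kernel W.
exists [set f | exists j, f = linear_form (col j C)]; split.
  by move=> _ [j ->]; exists 1%N; apply: linear_form_homog.
apply/seteqP; split=> p; have [v v0 pv] := point_gen p.
  move=> /(linear_subspace_line _ pv); rewrite WC => /eqP vC f /= [j ->].
  apply/(vanishes_line (linear_form_homog _) v0 pv).
  by rewrite meval_linear_form colE mulmxA vC mul0mx mxE.
move=> fp; apply/(linear_subspace_line _ pv); rewrite WC; apply/eqP/rowP=> j.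
have /(vanishes_line (linear_form_homog _) v0 pv) := fp _ (ex_intro _ j erefl).
by rewrite meval_linear_form colE mulmxA -colE !mxE.
Qed.

(** If [W] were the union of two proper algebraic subsets, each would lie in the zero set of a form
    not identically zero on [W]. The product of the two forms, in coordinates of [W], is a nonzero
    polynomial, so some point of [W] escapes both subsets. *)
Lemma irreducible_linear W : W != 0%VS -> irreducible_set (linear_subspace (R := R) W).
Proof.
move=> W0; split; [exact: algebraic_linear|exact: linear_subspace_neq0|].
move=> A1 A2 algA1 algA2 WA; apply: contrapT => /not_orP[nA1 nA2].
have [B [Bfree WB]] := vspace_matrix W.
have escape A : algebraic A -> A `<=` linear_subspace (R := R) W ->
    linear_subspace W <> A -> exists2 q : {mpoly K[\dim W]}, q != 0 &
      forall u : 'rV_(\dim W), u *m B != 0 -> q.@[u ord0] != 0 ->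
        forall p, val p = <[u *m B]>%VS -> ~ A p.
  move=> [S [Sh ->]] sAW nWA.
  have [p Wp nAp] : exists2 p, linear_subspace (R := R) W p & ~ forall f, S f -> vanishes f p.
    apply: contrapT => nex; apply: nWA; apply/seteqP; split=> // p Wp.
    by apply: contrapT => nAp; apply: nex; exists p.
  move/existsNP: nAp => [f /not_implyP[Sf nfp]].
  have [d fd] := Sh f Sf; exists (subst_rows B f).
    have [v v0 pv] := point_gen p.
    apply: contra_notN nfp => /eqP q0; apply/(vanishes_line fd v0 pv).
    move: Wp => /(linear_subspace_line _ pv); rewrite WB => /submxP[u ->].
    by rewrite -meval_subst_rows q0 meval0.
  move=> u uB; rewrite meval_subst_rows => /eqP fu p' p'u Ap'; apply: fu.
  by apply/(vanishes_line fd uB p'u); apply: Ap'.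
have [||q1 q10 hq1] := escape A1 algA1; [by rewrite WA; left|by []|].
have [||q2 q20 hq2] := escape A2 algA2; [by rewrite WA; right|by []|].
have rW : (0 < \dim W)%N by rewrite lt0n dimv_eq0.
(* The extra variable forces the chosen [u] to be nonzero, so that [u *m B] spans a projective
   point. *)
have : q1 * q2 * 'X_(Ordinal rW) != 0.
  rewrite !mulf_neq0 //; apply/eqP => /(congr1 (fun q => q@_U_(Ordinal rW))).
  by rewrite mcoeffXU eqxx mcoeff0 => /eqP; rewrite oner_eq0.
move=> /meval_neq0[u']; pose u : 'rV_(\dim W) := \row_i u' i.
rewrite (@meval_eq _ _ _ (u ord0)) => [|i]; last by rewrite mxE.
rewrite !mevalM mevalXU !mulf_eq0 !negb_or => /andP[/andP[uq1 uq2] u0].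
have uB : u *m B != 0.
  apply: contraNneq u0; rewrite -(mul0mx _ B) => /(row_free_inj Bfree) ->.
  by rewrite mxE.
have [p pu] := point_of uB.
have : linear_subspace (R := R) W p by apply/(linear_subspace_line _ pu); rewrite WB submxMl.
by rewrite WA => -[]; [apply: hq1 pu|apply: hq2 pu].
Qed.

End Projective.

(** * Dimension and components of a union of linear subspaces *)

Section Dimension.
Variables (R : realType) (N : nat).
Local Open Scope classical_set_scope.
Local Notation K := R[i].
Local Notation CP := (CP R N).
Implicit Types (p : CP) (X Z : set CP) (W : {vspace 'rV[K]_N}) (v : 'rV[K]_N).

Lemma cone0 Z : Z !=set0 -> cone Z 0.
Proof. by move=> [p Zp]; exists p; rewrite ?mem0v. Qed.

(** Otherwise each [W] in [s] has a linear form vanishing on [W] but not on all of [Z]; the product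
    of these forms vanishes on the union but, by primality, not on [Z]. *)
Lemma irreducible_sub_union Z (s : seq {vspace 'rV[K]_N}) : irreducible_set Z ->
  Z `<=` \bigcup_(W in [set` s]) linear_subspace W ->
  exists2 W, W \in s & Z `<=` linear_subspace W.
Proof.
move=> irrZ Zs; apply: contrapT => nZ.
have [d [f [fd fs nfZ]]] : exists d (f : {mpoly K[N]}), [/\ f \is d.-homog,
    forall W p, W \in s -> linear_subspace W p -> vanishes f p &
    ~ (forall v, cone Z v -> f.@[v ord0] = 0)].
  elim: s nZ {Zs} => [|W s IHs] nZ.
    (* The empty product is [1]; it does not vanish on the cone because [Z] is nonempty. *)
    exists 0%N, 1; split=> //; first exact: dhomog1.
    case: irrZ => _ /cone0 Z0 _ /(_ _ Z0) /eqP.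
    by rewrite meval1 oner_eq0.
  have [|d [f [fd fs nfZ]]] := IHs.
    by move=> [W' W's ZW']; apply: nZ; exists W'; rewrite // inE W's orbT.
  have [p Zp nWp] : exists2 p, Z p & ~ linear_subspace W p.
    apply: contrapT => nex; apply: nZ; exists W; rewrite ?mem_head // => p Zp.
    by apply: contrapT => nWp; apply: nex; exists p.
  have [v v0 pv] := point_gen p.
  have /linear_form_separates[c [cW cv]] : v \notin W.
    by apply: contra_notN nWp => vW; apply/(linear_subspace_line _ pv).
  exists (1 + d)%N, (linear_form c * f); split.
  - exact: dhomogM (linear_form_homog c) fd.
  - move=> W' p'; rewrite inE => /predU1P[->|W's] Wp' w wp' w0.
      by rewrite mevalM cW ?mul0r //; apply: (subvP Wp').
    by rewrite mevalM (fs _ _ W's Wp') ?mulr0.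
  - case/(irreducible_prime irrZ (linear_form_homog c) fd) => // /(_ v) cv0.
    by case/eqP: cv; apply: cv0; exists p; rewrite // pv memv_line.
apply: nfZ; apply/(cone_vanishes _ fd) => p Zp.
by have [W Ws Wp] := Zs p Zp; apply: fs Ws Wp.
Qed.

Lemma homog0_vanishes0 (f : {mpoly K[N]}) (v : 'rV_N) : f \is 0.-homog ->
  f.@[(0 : 'rV_N) ord0] = 0 -> f.@[v ord0] = 0.
Proof.
move=> fd; rewrite (@meval_eq _ _ _ (fun i => 0 * v ord0 i)) => [|i].
  by rewrite (dhomog_meval_scale _ _ fd) expr0 mul1r.
by rewrite mxE mul0r.
Qed.

(* The chain is extended downwards by the cone {0}; the defining polynomials
   of its steps, raised to a common degree, are algebraically independent on
   the largest member, which lies in a single linear subspace. *)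
Lemma krull_bound X (s : seq {vspace 'rV[K]_N}) m n :
  X `<=` \bigcup_(W in [set` s]) linear_subspace W ->
  (forall W, W \in s -> \dim W <= m)%N -> has_chain X n -> (n <= m)%N.
Proof.
move=> Xs dims; case: n => // n [Z [irrZ incrZ]].
(* Indices shift by one: the [n.+1] members [Z 0], ..., [Z n] give [n.+1] strict steps from [Y 0] to
   [Y n.+1]. *)
pose Y k : 'rV[K]_N -> Prop := if k is k'.+1 then cone (Z k') else [set 0].
have Y_0 k : (k <= n.+1)%N -> Y k 0.
  by case: k => // k /irrZ[[_ Z0 _] _]; apply: cone0.
have Ysub k v : (k < n.+1)%N -> Y k v -> Y k.+1 v.
  case: k => [|k] kn; first by move=> ->; apply: Y_0.
  by move=> [p Zp vp]; exists p => //; apply: (incrZ k kn).1.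
have step (k : 'I_n.+1) : exists df : nat * {mpoly K[N]},
    [/\ (0 < df.1)%N, df.2 \is df.1.-homog,
        forall v, Y k v -> df.2.@[v ord0] = 0 &
        ~ forall v, Y k.+1 v -> df.2.@[v ord0] = 0].
  have [d [f [fd fk fSk]]] : exists d (f : {mpoly K[N]}), [/\ f \is d.-homog,
        forall v, Y k v -> f.@[v ord0] = 0 &
        ~ forall v, Y k.+1 v -> f.@[v ord0] = 0].
    case: k => [[|k] kn] /=.
      have [[_ [p Zp] _] _] := irrZ 0%N kn; have [v v0 pv] := point_gen p.
      have /linear_form_separates[c [c0 cv]] : v \notin 0%VS by rewrite memv0.
      exists 1%N, (linear_form c); split=> [|w ->|/(_ v) cv0].
      - exact: linear_form_homog.
      - by apply: c0; apply: mem0v.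
      - by case/eqP: cv; apply: cv0; exists p; rewrite // pv memv_line.
    have [[[S [Sh ZS]] _ _] _] := irrZ k (ltnW kn).
    have [sZ nsZ] := incrZ k kn.
    have [p Zp nSp] : exists2 p, Z k.+1 p & ~ forall f, S f -> vanishes f p.
      apply: contrapT => nex; apply: nsZ => p Zp; rewrite ZS /=.
      by apply: contrapT => nSp; apply: nex; exists p.
    move/existsNP: nSp => [f /not_implyP[Sf nfp]]; have [d fd] := Sh f Sf.
    exists d, f; split=> //; first apply/(cone_vanishes _ fd) => q.
      by rewrite ZS => /(_ f Sf).
    by apply: contra_not nfp => /(cone_vanishes _ fd); apply.
  (* A form of degree 0 is constant; vanishing at [0], which lies in [Y k], it would vanish
     everywhere. *)
  exists (d, f); split=> //=; rewrite lt0n; apply: contra_notN fSk => /eqP d0 v _.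
  by rewrite d0 in fd; apply: homog0_vanishes0 fd (fk 0 (Y_0 _ (ltnW (ltn_ord k)))).
have /choice[df hdf] := step.
(* [E] is a common multiple of the degrees; suitable powers bring all forms to degree [E] without
   changing their zeros. *)
pose E := (\prod_k (df k).1)%N.
have E_gt0 : (0 < E)%N by rewrite prodn_gt0 // => k; have [] := hdf k.
have dvdE k : ((df k).1 %| E)%N by rewrite /E (bigD1 k) //= dvdn_mulr.
pose g := [tuple (df k).2 ^+ (E %/ (df k).1) | k < n.+1].
have gE k v : (tnth g k).@[v ord0] = (df k).2.@[v ord0] ^+ (E %/ (df k).1).
  by rewrite tnth_mktuple rmorphXn.
have ghomog k : tnth g k \is E.-homog.
  have [_ dh _ _] := hdf k; rewrite tnth_mktuple -{2}(divnK (dvdE k)) mulnC.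
  exact: dhomogMn.
have gY (k : 'I_n.+1) v : Y k v -> (tnth g k).@[v ord0] = 0.
  have [d0 _ h _] := hdf k; move=> /h hv; rewrite gE hv expr0n gtn_eqF //.
  by rewrite divn_gt0 // dvdn_leq.
have gYS (k : 'I_n.+1) : ~ forall v, Y k.+1 v -> (tnth g k).@[v ord0] = 0.
  have [_ _ _ h] := hdf k; apply: contra_not h => h v /h /eqP.
  by rewrite gE expf_eq0 => /andP[_ /eqP].
have Yprime k d d' (p q : {mpoly K[N]}) : (k < n.+1)%N -> p \is d.-homog -> q \is d'.-homog ->
    (forall v, Y k.+1 v -> (p * q).@[v ord0] = 0) ->
    (forall v, Y k.+1 v -> p.@[v ord0] = 0) \/
    (forall v, Y k.+1 v -> q.@[v ord0] = 0).
  by move=> kn pd qd; have [irr _] := irrZ k kn; apply: irreducible_prime irr pd qd.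
have [irrn ZX] := irrZ n (ltnSn n).
have [W Ws ZW] := irreducible_sub_union irrn (subset_trans ZX Xs).
apply: leq_trans (dims W Ws); rewrite leqNgt; apply/negP => dimW.
have [B [_ WB]] := vspace_matrix W.
have W_gt0 : (0 < \dim W < n.+1)%N.
  rewrite dimW andbT lt0n dimv_eq0; apply/eqP => W0.
  have [_ [p Zp] _] := irrn; have := ZW p Zp.
  by rewrite W0 linear_subspace0.
(* In coordinates of [W] these are [n.+1] forms in fewer variables, hence dependent; the relation
   holds on [W], so on the cone over [Z n], against independence along the chain. *)
pose h := [tuple subst_rows B (tnth g k) | k < n.+1].
have hh k : tnth h k \is E.-homog by rewrite tnth_mktuple subst_rows_homog.
have [d [F [F0 Fd Fh]]] := homog_algebraic_dependence W_gt0 hh.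
case/eqP: F0; apply: (chain_algebraic_independence ghomog _ Ysub gY gYS Yprime Fd) => //.
move=> v [p Zp vp]; have := subvP (ZW p Zp) v vp.
rewrite WB => /submxP[u ->].
have := congr1 (meval (u ord0)) Fh; rewrite meval0; apply: etrans.
rewrite !comp_mpoly_meval; apply: meval_eq => k.
by rewrite [tnth h _]tnth_mktuple meval_subst_rows.
Qed.

(** Initial segments of a basis span the chain; they start at length 1 so that every member is
    nonempty. *)
Lemma has_chain_linear X W : linear_subspace W `<=` X -> has_chain X (\dim W).
Proof.
move=> WX; pose V i := <<take i.+1 (vbasis W)>>%VS.
have dimV i : (i < \dim W)%N -> \dim (V i) = i.+1.
  move=> iW; have : free (take i.+1 (vbasis W)).
    apply: (@catl_free _ _ (drop i.+1 (vbasis W))).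
    by rewrite cat_take_drop (basis_free (vbasisP W)).
  by rewrite /free => /eqP->; rewrite size_takel // size_tuple.
exists (fun i => linear_subspace (V i)); split=> i iW.
  split; first by apply: irreducible_linear; rewrite -dimv_eq0 dimV.
  apply: subset_trans WX; apply/linear_subspace_sub/span_subvP => v /mem_take.
  exact: vbasis_mem.
split.
  apply/linear_subspace_sub/sub_span => v.
  by rewrite -(@take_takel _ i.+1 i.+2) // => /mem_take.
move=> /linear_subspace_sub/dimvS; rewrite !dimV ?ltnn //; exact: ltnW.
Qed.

Lemma proj_dim_unique X m : has_chain X m ->
  (forall n, has_chain X n -> (n <= m)%N) -> proj_dim X = m%:Z - 1.
Proof.
move=> cm ub; rewrite /proj_dim; set S := (S in xget _ S).
have [|cx ubx] := @xgetPex _ 0%N S; first by exists m; split.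
by congr (Posz _ - 1); apply/eqP; rewrite eqn_leq (ub _ cx) (ubx _ cm).
Qed.

Lemma proj_dim_union (s : seq {vspace 'rV[K]_N}) W : W \in s ->
  (forall W', W' \in s -> \dim W' <= \dim W)%N ->
  proj_dim (\bigcup_(W' in [set` s]) linear_subspace (R := R) W') = (\dim W)%:Z - 1.
Proof.
move=> Ws Wmax; apply: proj_dim_unique => [|n]; last by apply: krull_bound Wmax.
by apply: has_chain_linear => p Wp; exists W.
Qed.

Lemma proj_dim_linear W : proj_dim (linear_subspace (R := R) W) = (\dim W)%:Z - 1.
Proof.
have := @proj_dim_union [:: W] W; rewrite mem_head => <- //.
  congr proj_dim; apply/seteqP; split=> [p Wp|p [W' /=]].
    by exists W; rewrite //= inE.
  by rewrite inE => /eqP->.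
by move=> W'; rewrite inE => /eqP->.
Qed.

(** An irreducible subset lies in a single member of [s]: a component therefore equals that member,
    and an irreducible set containing a member [W] equals [W] because [s] is an antichain. The zero
    space is excluded since its projective set is empty. *)
Lemma component_union (s : seq {vspace 'rV[K]_N}) Z :
  (forall W W', W \in s -> W' \in s -> (W <= W')%VS -> W = W') ->
  component (\bigcup_(W in [set` s]) linear_subspace (R := R) W) Z <->
  exists2 W, W \in s /\ W != 0%VS & Z = linear_subspace W.
Proof.
move=> anti; split=> [[irrZ ZX Zmax]|[W [Ws W0] ->]].
  have [W Ws ZW] := irreducible_sub_union irrZ ZX.
  have W0 : W != 0%VS.
    apply/eqP => W0; have [_ [p Zp] _] := irrZ; have := ZW p Zp.
    by rewrite W0 linear_subspace0.
  exists W => //; apply/esym/Zmax => //; first exact: irreducible_linear.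
  by move=> p Wp; exists W.
split=> [|p Wp|Z' irrZ' WZ' Z'X]; [exact: irreducible_linear|by exists W|].
have [W' W's Z'W'] := irreducible_sub_union irrZ' Z'X.
have /linear_subspace_sub/anti eW := subset_trans WZ' Z'W'.
by apply/seteqP; split; rewrite // [W]eW.
Qed.

End Dimension.

(** * Degree of a linear subspace *)

Section Degree.
Variables (R : realType) (N : nat).
Local Open Scope classical_set_scope.
Local Notation K := R[i].
Local Notation CP := (CP R N).
Implicit Types (p : CP) (Z : set CP) (W : {vspace 'rV[K]_N}).

(** With [r.+1] basis rows in [B] and [r] forms in [A], the section is the left kernel of [B *m A],
    a single line as soon as this matrix has rank [r]. *)
Lemma general_section_linear W : W != 0%VS ->
  general_section (linear_subspace (R := R) W) (\dim W).-1 1.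
Proof.
rewrite -dimv_eq0 -lt0n; have [B [Bfree WB]] := vspace_matrix W.
case: (\dim W) B Bfree WB => // r B Bfree WB _ /=.
(* [C] selects the first [r] rows, so [F] below is the corresponding maximal minor of [B *m A] for a
   generic matrix [A]. *)
pose C : 'M[K]_(r, r.+1) := pid_mx r.
pose M : 'M[{mpoly K[N * r]}]_(N, r) := \matrix_(i, j) 'X_(mxvec_index i j).
pose F := \det (map_mx (@mpolyC _ K) (C *m B) *m M).
have FE A : F.@[mxvec A ord0] = \det (C *m B *m A).
  rewrite -det_map_mx map_mxM -map_mx_comp; congr (\det (_ *m _)).
    by apply/matrixP=> i j; rewrite !mxE /= mevalC.
  by apply/matrixP=> i j; rewrite !mxE /= mevalXU mxvecE.
exists F.
  (* Since [B *m pinvmx B] is the identity, the minor is 1 at this [A], which shows that [F] is not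
     zero. *)
  pose A := pinvmx B *m (pid_mx r : 'M_(r.+1, r)).
  have : F.@[mxvec A ord0] != 0.
    rewrite FE mulmxA -(mulmxA C) mulmxVp // mulmx1 mul_pid_mx minnn.
    by rewrite (minn_idPr (leqnSn r)) pid_mx_1 det1 oner_eq0.
  by apply: contraNneq => ->; rewrite meval0.
move=> A; rewrite FE => detA.
have rBA : \rank (B *m A) = r.
  apply/eqP; rewrite eqn_leq rank_leq_col.
  have rCBA : \rank (C *m B *m A) = r by apply: mxrank_unit; rewrite unitmxE unitfE.
  by rewrite -[X in (X <= _)%N]rCBA -mulmxA mxrankM_maxr.
have rker : \rank (kermx (B *m A)) = 1%N by rewrite mxrank_ker rBA subSnn.
pose u := nz_row (kermx (B *m A)).
have u0 : u != 0 by rewrite nz_row_eq0 -mxrank_eq0 rker.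
have uker : (kermx (B *m A) <= u)%MS.
  by rewrite -(geq_leqif (mxrank_leqif_sup (nz_row_sub _))) rker rank_rV u0.
have uBA : u *m B *m A = 0 by rewrite -mulmxA; apply/sub_kermxP/nz_row_sub.
have uB : u *m B != 0.
  by apply: contraNneq u0; rewrite -(mul0mx _ B) => /(row_free_inj Bfree) ->.
have [p pu] := point_of uB.
suff -> : [set q | linear_subspace W q /\ forall v, v \in val q -> v *m A = 0]
          = [set p] by exact: card_set1.
apply/seteqP; split=> [q /= [Wq qA]|_ ->] /=.
  have [v v0 qv] := point_gen q; apply/val_inj; rewrite pu qv.
  move: Wq => /(linear_subspace_line _ qv); rewrite WB => /submxP[w vE].
  have := qA v; rewrite qv memv_line => /(_ isT); rewrite vE -mulmxA.
  move/sub_kermxP/submx_trans/(_ uker)/sub_rVP => [c wE].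
  have c0 : c != 0.
    by apply: contraNneq v0 => c0; rewrite vE wE c0 scale0r mul0mx.
  apply/eqP; rewrite wE -scalemxAl eqEdim -memvE memvZ ?memv_line //.
  by rewrite !dim_vline scaler_eq0 negb_or c0 uB.
split; first by apply/(linear_subspace_line _ pu); rewrite WB submxMl.
by move=> v; rewrite pu => /vlineP[c ->]; rewrite -scalemxAl uBA scaler0.
Qed.

(** Both generality conditions hold together wherever the nonzero polynomial [F * F'] does not
    vanish. *)
Lemma general_section_unique Z d k k' :
  general_section Z d k -> general_section Z d k' -> k = k'.
Proof.
move=> [F F0 hF] [F' F'0 hF'].
have /meval_neq0[u] : F * F' != 0 by rewrite mulf_neq0.
pose A : 'M[K]_(N, d) := vec_mx (\row_i u i).
rewrite (@meval_eq _ _ _ (mxvec A ord0)) => [|i]; last by rewrite vec_mxK mxE.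
rewrite mevalM mulf_eq0 negb_or => /andP[/hF Ak /hF' Ak'].
by apply/card_eq_II; rewrite -(card_eql Ak).
Qed.

Lemma degree_irr_linear W : W != 0%VS -> degree_irr (linear_subspace (R := R) W) = 1%N.
Proof.
move=> W0; have W_gt0 : (0 < \dim W)%N by rewrite lt0n dimv_eq0.
have WE : proj_dim (linear_subspace (R := R) W) = ((\dim W).-1)%:Z.
  by rewrite proj_dim_linear -[in LHS](prednK W_gt0) -addn1 PoszD addrK.
apply: xget_unique => [|k [d]].
  by exists (\dim W).-1 => //; apply: general_section_linear.
by rewrite WE => -[<-] /general_section_unique; apply; apply: general_section_linear.
Qed.

End Degree.

(** * Directed cycles *)

Section Dicycles.
Variable G : digraph.
Implicit Types (s t : dicycle_seq G) (c d : dicycle G) (A : {set edge G}).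

Lemma src_edges_inj s : {in edges_of s &, injective (@src G)}.
Proof.
have /and3P[_ _ us] := valP s => x y xs ys exy.
have e z : z \in edges_of s ->
    index (src z) (map src (edges_of s)) = index z (edges_of s).
  rewrite -/(edges_of s) in us.
  elim: (edges_of s) us => //= a l IHl /andP[al ul]; rewrite inE [z == a]eq_sym.
  have [->|nza] := eqVneq a z; first by rewrite !eqxx.
  move=> /= zl; case: eqP => [ea|_]; last by rewrite IHl.
  by rewrite ea map_f in al.
by rewrite -(nth_index x xs) -(nth_index x ys) -!e // exy.
Qed.

Lemma edges_uniq s : uniq (edges_of s).
Proof. by have /and3P[_ _ /map_uniq] := valP s. Qed.

Lemma edges_cycle s : cycle [rel x y | tgt x == src y] (edges_of s).
Proof. by have /and3P[] := valP s. Qed.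

Lemma edges_neq0 s : edges_of s != [::].
Proof. by have /and3P[] := valP s. Qed.

(* Along a cycle of [t] the next edge is determined by its initial vertex, so
   both sequences follow the same successor function. *)
Lemma edges_subset_rotation s t :
  {subset edges_of s <= edges_of t} -> rotation s t.
Proof.
move=> st; pose f := next (edges_of t).
have ft : fcycle f (edges_of t) := cycle_next (edges_uniq t).
have fs : fcycle f (edges_of s).
  apply: (@sub_in_cycle _ (mem (edges_of t)) _ _ _ (edges_of s) _ (edges_cycle s)).
    move=> x y xt yt /= /eqP exy; apply/eqP.
    apply: (@src_edges_inj t) => //; first by rewrite mem_next.
    by rewrite -exy; apply/esym/eqP/(next_cycle (edges_cycle t)).
  exact/allP.
have [x xs] : exists x, x \in edges_of s.
  by have := edges_neq0 s; case: (edges_of s) => // x l _; exists x; apply: mem_head.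
(* A duplicate-free cycle of [f] is a rotation of the orbit of any of its members, and [s] and [t]
   share [x]. *)
have eqst : edges_of s =i edges_of t.
  move=> y; rewrite -(mem_rot (index x (edges_of s))) -(orbitE fs (edges_uniq s) xs).
  by rewrite (orbitE ft (edges_uniq t)) ?mem_rot // st.
have := edges_neq0 t; rewrite /rotation.
case et: (edges_of t) => [//|y l] _.
have yt : y \in edges_of t by rewrite et mem_head.
have ys : y \in edges_of s by rewrite eqst.
apply/mapP; exists (index y (edges_of s)).
  by rewrite mem_iota /= add0n index_mem.
by rewrite -(orbitE fs (edges_uniq s) ys) (orbitE ft (edges_uniq t) yt) et /= eqxx rot0.
Qed.

Lemma rotationP s t : reflect (edges_of s =i edges_of t) (rotation s t).
Proof.
apply: (iffP idP) => [/mapP[i _ -> x]|st]; first by rewrite mem_rot.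
by apply: edges_subset_rotation => x; rewrite st.
Qed.

Lemma dicycle_repr c : exists2 s, forall t, (t \in val c) = rotation s t &
  cycle_edges c = [set x in edges_of s].
Proof.
have /imsetP[s _ cs] := valP c; exists s => [t|]; first by rewrite cs !inE.
apply/setP=> x; rewrite !inE; apply/exists_inP/idP => [[t]|xs].
  by rewrite cs !inE => /rotationP->.
by exists s; rewrite // cs !inE /=; apply/rotationP.
Qed.

Lemma dicycle_of_seq s : exists c, cycle_edges c = [set x in edges_of s].
Proof.
have cP : [set t in [set: dicycle_seq G] | rotation s t]
    \in equivalence_partition (@rotation G) [set: dicycle_seq G].
  by apply/imsetP; exists s.
pose c : dicycle G := exist (fun B => B \in equivalence_partition _ _) _ cP.
exists c.
apply/setP=> x; rewrite !inE; apply/exists_inP/idP => [[t]|xs].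
  by rewrite !inE => /rotationP->.
by exists s; rewrite // !inE /=; apply/rotationP.
Qed.

(** Inclusion of edge sets already forces representatives to be rotations of each other; in
    particular a cycle is determined by its edge set. *)
Lemma cycle_edges_sub c d : cycle_edges c \subset cycle_edges d -> c = d.
Proof.
have [s cs ->] := dicycle_repr c; have [t dt ->] := dicycle_repr d => /fintype.subsetP st.
have /rotationP est : rotation s t.
  by apply: edges_subset_rotation => x xs; have := st x; rewrite !inE; apply.
apply/val_inj/setP=> u; rewrite cs dt.
by apply/rotationP/rotationP => eu x; rewrite -eu est.
Qed.

Lemma cycle_edges_neq0 c : exists x, x \in cycle_edges c.
Proof.
have [s _ ->] := dicycle_repr c; have := edges_neq0 s.
by case: (edges_of s) => // x l _; exists x; rewrite inE mem_head.
Qed.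

Definition balanced A := forall u : vertex G,
  #|[set x in A | src x == u]%SET| = #|[set x in A | tgt x == u]%SET|.

(** The list of targets along a cycle is the list of sources shifted by one place. *)
Lemma cycle_balanced c : balanced (cycle_edges c).
Proof.
have [s _ ->] := dicycle_repr c; move=> u.
have cardE (h : edge G -> vertex G) :
    #|[set x in [set x in edges_of s] | h x == u]%SET| = count_mem u (map h (edges_of s)).
  rewrite count_map -size_filter -(card_uniqP (filter_uniq _ (edges_uniq s))).
  by apply: eq_card => x; rewrite !inE mem_filter andbC.
rewrite !cardE; apply/permP; have := edges_cycle s.
case: (edges_of s) => // x l /=.
have tgtE y m : path [rel x y | tgt x == src y] y m -> map tgt (belast y m) = map src m.
  by elim: m y => //= z m IHm y /andP[/eqP-> /IHm->].
move/tgtE; rewrite belast_rcons map_rcons => /= ->.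
by rewrite perm_sym perm_rcons.
Qed.

(** Balance provides, after each edge of [A], an edge of [A] leaving its target; walking along a
    fixed choice [f] of such edges must eventually loop. *)
Lemma balanced_cycle A : balanced A -> (exists x, x \in A) ->
  exists c, cycle_edges c \subset A.
Proof.
move=> balA [x0 x0A].
pose f x := odflt x0 [pick y in A | src y == tgt x].
have fP x : x \in A -> (f x \in A) /\ src (f x) = tgt x.
  move=> xA; rewrite /f; case: pickP => [y /andP[yA /eqP]//|no].
  have : (0 < #|[set y in A | src y == tgt x]%SET|)%N.
    by rewrite balA; apply/card_gt0P; exists x; rewrite inE xA eqxx.
  by case/card_gt0P=> y; rewrite inE no.
have iterA k x : x \in A -> iter k f x \in A.
  by move=> xA; elim: k => //= k /fP[].
(* The walk from [x0] first repeats at its [i]-th edge [y], so the orbit of [y] is closed under [f]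
   without the initial tail. *)
have /trajectP[i lt_in e_in] := looping_order f x0.
set y := iter i f x0 in e_in.
have yA : y \in A by apply: iterA.
have fcy : fcycle f (orbit f y).
  apply/(orbitPcycle 0 3); exists (order f x0 - i).-1.
  by rewrite prednK ?subn_gt0 // /y -iterD subnK // ltnW.
have orbA x : x \in orbit f y -> x \in A by case/trajectP=> k _ ->; apply: iterA.
have cyc : cycle [rel x y | tgt x == src y] (orbit f y).
  apply: (@sub_in_cycle _ (mem A) _ _ _ (orbit f y) _ fcy); last exact/allP.
  by move=> a b aA _ /= /eqP <-; have [_ ->] := fP a aA.
(* [f x] depends only on the target of [x]: two edges of the orbit with one source have predecessors
   with one target, hence coincide. *)
have usrc : uniq (map src (orbit f y)).
  rewrite map_inj_in_uniq ?orbit_uniq // => a b ao bo eab.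
  have /eqP ea := prev_cycle fcy ao; have /eqP eb := prev_cycle fcy bo.
  have [_ sa] := fP _ (orbA _ (etrans (mem_prev _ _) ao)).
  have [_ sb] := fP _ (orbA _ (etrans (mem_prev _ _) bo)).
  by rewrite -ea -eb /f -sa -sb ea eb eab.
have szo : (size (orbit f y) <= #|vertex G|)%N.
  by rewrite -(size_map src) -(card_uniqP usrc) max_card.
have sP : is_dicycle_seq (Bseq szo).
  apply/and3P; split=> //=.
  by have := in_orbit f y; case: (orbit f y).
have [c ce] := dicycle_of_seq (exist (fun t : #|vertex G|.-bseq (edge G) => is_dicycle_seq t) _ sP).
by exists c; rewrite ce; apply/fintype.subsetP=> x; rewrite inE; apply: orbA.
Qed.

End Dicycles.

(** * Multisets of nonzero values *)

(** The generating function of the elementary symmetric polynomials, expanded over the set [J] of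
    factors contributing [a i *: 'X]. *)
Lemma coef_prod_1addaX (R : comNzRingType) n (a : 'I_n -> R) k :
  (\prod_i (1 + a i *: 'X))`_k = (mesym n R k).@[a].
Proof.
rewrite (eq_bigr (fun i => a i *: 'X + 1)) => [|i _]; last exact: addrC.
rewrite bigA_distr coef_sum rmorph_sum [RHS]big_mkcond /=; apply: eq_bigr => J _.
have -> : \prod_i (if i \in J then a i *: 'X else 1 : {poly R})
    = (\prod_(i in J) a i) *: 'X^#|J|.
  by rewrite -big_mkcond /= scaler_prod prodr_const.
rewrite coefZ coefXn eq_sym; case: eqP => _; last by rewrite mulr0.
by rewrite mulr1 rmorph_prod; apply: eq_bigr => i _; rewrite /= mevalXU.
Qed.

Section EdgeValues.
Variables (K : fieldType) (T : finType).
Implicit Types (v : T -> K) (A B : {set T}).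

(** A nonzero [b] occurs in the list exactly when [- b^-1] is a root of the product; a common factor
    can then be cancelled, by induction. *)
Lemma prod_1addaX_perm (s t : seq K) : 0 \notin s -> 0 \notin t ->
  \prod_(a <- s) (1 + a *: 'X) = \prod_(a <- t) (1 + a *: 'X) :> {poly K} ->
  perm_eq s t.
Proof.
have rootE (r : seq K) b : b != 0 ->
    root (\prod_(a <- r) (1 + a *: 'X)) (- b^-1) = (b \in r).
  move=> b0; elim: r => [|a r IHr]; first by rewrite big_nil; apply/negbTE/root1.
  rewrite big_cons rootM IHr inE; congr (_ || _).
  rewrite /root !hornerE mulrN subr_eq0 eq_sym; apply/eqP/eqP=> [ab|<-].
    by rewrite -[LHS]mul1r -ab mulfVK.
  by rewrite mulfV.
elim: s t => [|b s IHs] t s0 t0 est.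
  case: t t0 est => // b t; rewrite inE negb_or eq_sym => /andP[b0 _] est.
  have := rootE [::] b b0; rewrite est rootE // mem_head.
  by [].
have b0 : b != 0 by apply: contraNneq s0 => ->; rewrite mem_head.
have bt : b \in t by rewrite -rootE // -est rootE ?mem_head.
rewrite perm_sym (perm_trans (perm_to_rem bt)) // perm_cons perm_sym.
apply: IHs.
- by apply: contra s0; rewrite inE => ->; rewrite orbT.
- by apply: contra t0 => /mem_rem.
have nz : 1 + b *: 'X != 0 :> {poly K}.
  apply/eqP => /(congr1 (fun p : {poly K} => p`_0)) /eqP.
  by rewrite coefD coefZ coefX mulr0 addr0 coef1 coef0 oner_eq0.
apply: (mulfI nz); move: est; rewrite big_cons => ->.
by rewrite (perm_big _ (perm_to_rem bt)) /= big_cons.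
Qed.

(* Zero values contribute the factor 1, so only the multiset of nonzero
   values matters. *)
Lemma prod_1addaX_eq v A B :
  \prod_(x in A) (1 + v x *: 'X) = \prod_(x in B) (1 + v x *: 'X) :> {poly K} <->
  forall c, c != 0 -> #|[set x in A | v x == c]%SET| = #|[set x in B | v x == c]%SET|.
Proof.
pose vals (C : {set T}) := [seq v x | x <- enum C & v x != 0].
have vals0 C : 0 \notin vals C.
  by apply/mapP => -[x]; rewrite mem_filter => /andP[/eqP v0 _] /esym.
have prodE (C : {set T}) : \prod_(x in C) (1 + v x *: 'X) =
    \prod_(a <- vals C) (1 + a *: 'X) :> {poly K}.
  rewrite big_map big_filter big_enum_cond /= [RHS]big_mkcondr /=.
  by apply: eq_bigr => x _; case: eqP => // ->; rewrite scale0r addr0.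
have countE (C : {set T}) c : c != 0 -> count_mem c (vals C) = #|[set x in C | v x == c]%SET|.
  move=> c0; rewrite count_map count_filter -size_filter.
  rewrite -(card_uniqP (filter_uniq _ (enum_uniq C))).
  apply: eq_card => x; rewrite !inE mem_filter mem_enum /= andbC.
  by case: eqP => // ->; rewrite c0.
have -> : \prod_(x in A) (1 + v x *: 'X) = \prod_(x in B) (1 + v x *: 'X) :> {poly K}
    <-> perm_eq (vals A) (vals B).
  rewrite !prodE; split=> [|eAB]; first exact: prod_1addaX_perm.
  exact: perm_big.
split=> [/permP eAB c c0|eAB]; first by rewrite -!countE.
apply/allP => c _ /=; apply/eqP; have [->|c0] := eqVneq c 0; last by rewrite !countE ?eAB.
by rewrite !(count_memPn (vals0 _)).
Qed.
End EdgeValues.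

(** * Spans of edge-disjoint cycles *)

Section CycleSpans.
Variables (K : fieldType) (G : digraph).
Local Notation N := #|edge G|.
Implicit Types (v : 'rV[K]_N) (x : edge G) (u : vertex G) (c d : dicycle G).
Implicit Types (A B : {set dicycle G}).

Definition edge_val v x := v ord0 (enum_rank x).

Definition cycle_vec c : 'rV[K]_N := \row_i (enum_val i \in cycle_edges c)%:R.

Definition cycle_span A : {vspace 'rV[K]_N} := (\sum_(c in A) <[cycle_vec c]>)%VS.

(** The combinatorial form of the equations of the incidence set; zero values are left
    unconstrained. *)
Definition level_balanced v :=
  forall a, a != 0 -> balanced [set x | edge_val v x == a]%SET.

Lemma edge_val_cycle_vec c x : edge_val (cycle_vec c) x = (x \in cycle_edges c)%:R.
Proof. by rewrite /edge_val mxE enum_rankK. Qed.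

Lemma edge_val_inj v w : edge_val v =1 edge_val w -> v = w.
Proof. by move=> vw; apply/rowP=> i; rewrite -(enum_valK i); apply: vw. Qed.

Lemma edge_disjointP A :
  reflect (forall c d x, c \in A -> d \in A -> x \in cycle_edges c ->
    x \in cycle_edges d -> c = d) (edge_disjoint A).
Proof.
apply: (iffP idP) => [/forall_inP dA c d x cA dA' xc xd|dA].
  apply/eqP; apply: contraT => ncd.
  have /forall_inP/(_ d dA')/implyP/(_ ncd) := dA c cA.
  by move=> /pred0P/(_ x) /=; rewrite xc xd.
apply/forall_inP => c cA; apply/forall_inP => d dA'; apply/implyP => ncd.
apply/pred0P => x /=; apply: contraNF ncd => /andP[xc xd].
by rewrite (dA c d x).
Qed.

Lemma cycle_spanP A v : v \in cycle_span A <->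
  exists a : dicycle G -> K, v = \sum_(c in A) a c *: cycle_vec c.
Proof.
split=> [/memv_sumP[vs vsA ->]|[a ->]]; last first.
  by apply: memv_sumr => c cA; rewrite memvZ // memv_line.
have /choice[a ha] : forall c, exists a, c \in A -> vs c = a *: cycle_vec c.
  move=> c; have [cA|] := boolP (c \in A); last by exists 0.
  by have /vlineP[a ->] := vsA c cA; exists a.
by exists a; apply: eq_bigr => c /ha.
Qed.

Lemma edge_val_sum A a x : edge_val (\sum_(c in A) a c *: cycle_vec c) x =
  \sum_(c in A | x \in cycle_edges c) a c.
Proof.
rewrite /edge_val summxE big_mkcondr; apply: eq_bigr => c _.
by rewrite mxE -/(edge_val _ _) edge_val_cycle_vec mulr_natr mulrb.
Qed.

(** By disjointness only [c] contributes at [x], so the coefficients of a combination can be read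
    off its coordinates. *)
Lemma edge_val_sum_cycle A a c x : edge_disjoint A -> c \in A ->
  x \in cycle_edges c -> edge_val (\sum_(d in A) a d *: cycle_vec d) x = a c.
Proof.
move=> /edge_disjointP dA cA xc; rewrite edge_val_sum (bigD1 c) ?cA //=.
rewrite big1 ?addr0 // => d /andP[/andP[dA' xd]].
by rewrite (dA d c x) ?eqxx.
Qed.

Lemma edge_val_sum0 A a x : (forall c, c \in A -> x \notin cycle_edges c) ->
  edge_val (\sum_(d in A) a d *: cycle_vec d) x = 0.
Proof.
move=> xA; rewrite edge_val_sum big1 // => c /andP[cA xc].
by have := xA c cA; rewrite xc.
Qed.

(** If the indicator of [c] is a combination of cycles of [B], an edge of [c] lies on some [d] in
    [B] with coefficient 1; all edges of [d] then have value 1, so they lie on [c], and [d = c]. *)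
Lemma cycle_span_sub A B : edge_disjoint A -> edge_disjoint B ->
  (cycle_span A <= cycle_span B)%VS = (A \subset B).
Proof.
move=> dA dB; apply/idP/fintype.subsetP=> [/subvP sAB c cA|sAB]; last first.
  apply/subv_sumP => c cA; rewrite /cycle_span (bigD1 c) ?sAB //.
  exact: addvSl.
have /sAB/cycle_spanP[a ac] : cycle_vec c \in cycle_span A.
  by rewrite /cycle_span (bigD1 c) //=; apply: (subvP (addvSl _ _)); apply: memv_line.
have [x xc] := cycle_edges_neq0 c.
have [/exists_inP[d dB' xd]|] := boolP [exists d in B, x \in cycle_edges d]; last first.
  rewrite negb_exists_in => /forall_inP nx.
  have := edge_val_sum0 a nx; rewrite -ac edge_val_cycle_vec xc => /eqP.
  by rewrite oner_eq0.
have ad : a d = 1.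
  by rewrite -(edge_val_sum_cycle a dB dB' xd) -ac edge_val_cycle_vec xc.
suff <- : d = c by [].
apply: cycle_edges_sub; apply/fintype.subsetP => y yd.
have := edge_val_sum_cycle a dB dB' yd; rewrite -ac edge_val_cycle_vec ad.
by case: (y \in _) => // /eqP; rewrite eq_sym oner_eq0.
Qed.

Lemma dim_cycle_span A : edge_disjoint A -> \dim (cycle_span A) = #|A|.
Proof.
move=> dA; have : directv (\sum_(c in A) <[cycle_vec c]>).
  apply/directv_sum_independent => us usA us0 c cA.
  have /choice[a ha] : forall c, exists a, c \in A -> us c = a *: cycle_vec c.
    move=> d; have [dA'|] := boolP (d \in A); last by exists 0.
    by have /vlineP[a ->] := usA d dA'; exists a.
  have [x xc] := cycle_edges_neq0 c.
  rewrite ha // -(edge_val_sum_cycle a dA cA xc).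
  have -> : \sum_(d in A) a d *: cycle_vec d = 0.
    by apply: etrans us0; apply: eq_bigr => d /ha.
  by rewrite /edge_val mxE scale0r.
move/directvP => /= ->; apply: etrans (sum1_card _); apply: eq_bigr => c _.
rewrite dim_vline; have [x xc] := cycle_edges_neq0 c.
suff -> : cycle_vec c != 0 by [].
apply/eqP => /(congr1 (edge_val ^~ x)); rewrite edge_val_cycle_vec xc /edge_val mxE.
by move/eqP; rewrite oner_eq0.
Qed.

(** The level set of a nonzero value [l] is the disjoint union of the cycles with coefficient [l],
    each of which is balanced. *)
Lemma cycle_span_level_balanced A v : edge_disjoint A -> v \in cycle_span A ->
  level_balanced v.
Proof.
move=> dA /cycle_spanP[a ->] l l0 u; set w := \sum_(c in A) _.
have cardE (h : edge G -> vertex G) :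
    #|[set x in [set x | edge_val w x == l] | h x == u]%SET| =
    (\sum_(c in A | a c == l) #|[set x in cycle_edges c | h x == u]%SET|)%N.
  rewrite -[LHS]sum1_card big_mkcond /=.
  under [RHS]eq_bigr do rewrite -[#|_|]sum1_card big_mkcond /=.
  rewrite exchange_big /=; apply: eq_bigr => x _; rewrite !inE.
  have [/exists_inP[c cA xc]|] := boolP [exists c in A, x \in cycle_edges c].
    rewrite (edge_val_sum_cycle a dA cA xc).
    have other d : d \in A -> d != c -> x \notin cycle_edges d.
      move=> dA' ndc; apply: contraNN ndc => xd.
      by rewrite (edge_disjointP _ dA d c x).
    case: eqP => [acl|nacl] /=; last first.
      rewrite big1 // => d /andP[dA' /eqP ad]; rewrite inE (negPf (other d dA' _)) //.
      by apply/eqP => dc; case: nacl; rewrite -dc.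
    rewrite (bigD1 c) ?cA ?acl ?eqxx //= inE xc /= big1 ?addn0 // => d.
    by case/andP=> /andP[dA' _] ndc; rewrite inE (negPf (other d dA' ndc)).
  rewrite negb_exists_in => /forall_inP nx.
  rewrite (edge_val_sum0 a nx) eq_sym (negPf l0) /= big1 // => c /andP[cA _].
  by rewrite inE (negPf (nx c cA)).
by rewrite !cardE; apply: eq_bigr => c _; apply: cycle_balanced.
Qed.

(** A nonzero level contains a cycle; subtracting that level times the indicator of the cycle
    shrinks the support and preserves balance, so induction on the support applies. *)
Lemma level_balanced_cycle_span v : level_balanced v ->
  exists2 A, edge_disjoint A & v \in cycle_span A.
Proof.
(* The added clause keeps the cycles of [A] inside the support of [v], which makes a removed cycle
   disjoint from those found afterwards. *)
move=> bv; suff [A [dA _ vA]] : exists A, [/\ edge_disjoint A,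
    forall c x, c \in A -> x \in cycle_edges c -> edge_val v x != 0 &
    v \in cycle_span A] by exists A.
have [n vn] := ubnP #|[set x | edge_val v x != 0]%SET|.
elim: n v vn bv => // n IHn v vn bv.
have [v0|/eqP v0] := eqVneq v 0.
  exists finset.set0; rewrite v0 mem0v; split=> // [|c x]; last by rewrite inE.
  by apply/edge_disjointP => c d x; rewrite inE.
have [x0 vx0] : exists x, edge_val v x != 0.
  apply: contrapT => nx; apply: v0; apply: edge_val_inj => x.
  by rewrite [RHS]mxE; apply/eqP; apply: contra_notT nx => vx; exists x.
set l := edge_val v x0 in vx0.
have [c cl] : exists c, cycle_edges c \subset [set x | edge_val v x == l]%SET.
  by apply: balanced_cycle (bv l vx0) _; exists x0; rewrite inE.
have vc x : x \in cycle_edges c -> edge_val v x = l.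
  by move=> xc; have := fintype.subsetP cl x xc; rewrite inE => /eqP.
pose w := v - l *: cycle_vec c.
have wE x : edge_val w x = if x \in cycle_edges c then 0 else edge_val v x.
  have -> : edge_val w x = edge_val v x - l * edge_val (cycle_vec c) x.
    by rewrite /edge_val !mxE.
  rewrite edge_val_cycle_vec; case: ifP => [/vc ->|_].
    by rewrite mulr1 subrr.
  by rewrite mulr0 subr0.
have levelE a : a != 0 -> [set x | edge_val w x == a]%SET
    = [set x | edge_val v x == a]%SET :\: cycle_edges c.
  move=> a0; apply/setP => x.
  rewrite finset.in_setD [LHS]finset.in_set [X in _ = _ && X]finset.in_set wE.
  case: (x \in cycle_edges c) => //=.
  by rewrite eq_sym (negPf a0).
have [||A [dA Av wA]] := IHn w.
- rewrite -ltnS; apply: leq_trans vn; rewrite ltnS proper_card //.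
  have [x xc] := cycle_edges_neq0 c; apply/properP; split.
    by apply/fintype.subsetP => y; rewrite !inE wE; case: ifP; rewrite ?eqxx.
  by exists x; rewrite !inE ?wE ?xc ?eqxx ?(vc x xc).
- move=> a a0 u; rewrite levelE //.
  have cardE (h : edge G -> vertex G) (B : {set edge G}) :
      #|[set x in B :\: cycle_edges c | h x == u]%SET| =
      (#|[set x in B | h x == u]%SET| -
       #|[set x in B :&: cycle_edges c | h x == u]%SET|)%N.
    rewrite -(cardsID (cycle_edges c) [set x in B | h x == u]%SET).
    have -> : ([set x in B | h x == u] :&: cycle_edges c =
        [set x in B :&: cycle_edges c | h x == u])%SET.
      by apply/setP => x; rewrite !inE andbAC.
    rewrite addKn; apply: eq_card => x; rewrite !inE.
    by rewrite andbA.
  rewrite !cardE bv //; congr (_ - _)%N.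
  (* The removed cycle lies entirely in the level [l] and meets no other level. *)
  have [al|nal] := eqVneq a l.
    have -> : [set x | edge_val v x == a]%SET :&: cycle_edges c = cycle_edges c.
      by apply/finset.setIidPr; rewrite al.
    exact: cycle_balanced.
  have -> : [set x | edge_val v x == a]%SET :&: cycle_edges c = finset.set0.
    apply/setP => x; rewrite finset.in_setI [RHS]inE [X in X && _]inE.
    apply/negP => /andP[/eqP va /vc vl].
    by case/eqP: nal; rewrite -va -vl.
  by apply: eq_card => x; rewrite !inE.
have Ac x d : d \in A -> x \in cycle_edges d -> x \notin cycle_edges c.
  by move=> dA' xd; have := Av d x dA' xd; rewrite wE; case: ifP; rewrite ?eqxx.
exists (c |: A); split.
- apply/edge_disjointP => d d' x; rewrite !finset.in_setU1.
  move=> /predU1P[->|dA1] /predU1P[->|dA2] // xd xd'.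
  + by have := Ac x _ dA2 xd'; rewrite xd.
  + by have := Ac x _ dA1 xd; rewrite xd'.
  + exact: (edge_disjointP _ dA) xd xd'.
- move=> d x; rewrite finset.in_setU1 => /predU1P[-> /vc ->|dA1 xd]; first exact: vx0.
  by have := Av d x dA1 xd; rewrite wE; case: ifP; rewrite ?eqxx.
- have -> : v = l *: cycle_vec c + w by rewrite addrC subrK.
  rewrite /cycle_span big_setU1 /=; last first.
    have [x xc] := cycle_edges_neq0 c.
    by apply/negP => cA; have := Ac x c cA xc; rewrite xc.
  by apply: memv_add => //; rewrite memvZ ?memv_line.
Qed.

End CycleSpans.

(** * The incidence set *)

Section Incidence.
Variables (K : fieldType) (G : digraph).
Local Notation N := #|edge G|.
Implicit Types (v : 'rV[K]_N) (x : edge G) (u : vertex G) (E : {set edge G}).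

Lemma meval_elem_sym E l v : (map_mpoly intr (elem_sym E l)).@[v ord0] =
  (\prod_(x in E) (1 + edge_val v x *: 'X))`_l.
Proof.
rewrite -big_enum (big_tuple _ _ (enum_tuple E) xpredT) coef_prod_1addaX.
rewrite /elem_sym /mesym (raddf_sum (comp_mpoly _)) (raddf_sum (map_mpoly intr)).
rewrite !(raddf_sum (meval _)); apply: eq_bigr => h _ /=.
rewrite (rmorph_prod (comp_mpoly _)) (rmorph_prod (map_mpoly intr)).
rewrite !(rmorph_prod (meval _)); apply: eq_bigr => i _ /=.
by rewrite comp_mpolyXU -tnth_nth tnth_map map_mpolyX !mevalXU.
Qed.

Lemma elem_sym0 E : elem_sym E 0 = 1.
Proof. by rewrite /elem_sym mesym0E comp_mpoly1. Qed.

Lemma elem_sym_gt E l : (#|E| < l)%N -> elem_sym E l = 0.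
Proof. by move=> El; rewrite /elem_sym mesym_geqnE // comp_mpoly0. Qed.

(** At each vertex the equations say that the generating polynomials of the outgoing and the
    incoming values have equal coefficients, hence that the nonzero values agree with
    multiplicity. *)
Lemma delta_level_balanced v :
  (forall u l, (1 <= l <= max_degree u)%N ->
    (map_mpoly intr (delta u l)).@[v ord0] = 0) <-> level_balanced v.
Proof.
have prodE u : (forall l, (1 <= l <= max_degree u)%N ->
      (map_mpoly intr (delta u l)).@[v ord0] = 0) <->
    \prod_(x in out_edges u) (1 + edge_val v x *: 'X)
      = \prod_(x in in_edges u) (1 + edge_val v x *: 'X) :> {poly K}.
  have deltaE l : (map_mpoly intr (delta u l)).@[v ord0] =
      (\prod_(x in out_edges u) (1 + edge_val v x *: 'X))`_l -
      (\prod_(x in in_edges u) (1 + edge_val v x *: 'X))`_l.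
    by rewrite -!meval_elem_sym /delta !rmorphB.
  split=> [du|eQ l _]; last by rewrite deltaE eQ subrr.
  apply/polyP => l; apply/eqP; rewrite -subr_eq0 -deltaE; apply/eqP.
  (* Outside the range of the equations the coefficients agree anyway: both are 1 at [l = 0] and
     both are 0 above [max_degree u]. *)
  have [->|l0] := posnP l; first by rewrite /delta !elem_sym0 subrr !rmorph0.
  have [lu|] := leqP l (max_degree u); first by apply: du; rewrite l0.
  rewrite /max_degree gtn_max => /andP[outl inl].
  by rewrite /delta !elem_sym_gt // subrr !rmorph0.
have setE (a : K) u : #|[set x in out_edges u | edge_val v x == a]%SET|
      = #|[set x in [set x | edge_val v x == a] | src x == u]%SET| /\
    #|[set x in in_edges u | edge_val v x == a]%SET|
      = #|[set x in [set x | edge_val v x == a] | tgt x == u]%SET|.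
  by split; apply: eq_card => x; rewrite !inE andbC.
split=> [dv a a0 u|bv u].
  have [<- <-] := setE a u.
  by have /prod_1addaX_eq : _ := (prodE u).1 (dv u); apply.
apply/prodE/prod_1addaX_eq => a a0; have [-> ->] := setE a u; exact: bv.
Qed.

End Incidence.

Local Open Scope classical_set_scope.

Lemma card_set_seq (T : choiceType) (s : seq T) :
  uniq s -> ([set` s] #= `I_(size s))%card.
Proof.
elim: s => [_|x s IHs /= /andP[xs us]].
  by have -> : [set` [::] : seq T] = set0; [apply/seteqP; split|rewrite II0 card_eq00].
apply/eq_cardSP; exists x; first exact: mem_head.
have -> : [set` x :: s] `\ x = [set` s]; last exact: IHs.
apply/seteqP; split=> y /=; first by rewrite inE => -[/predU1P[]].
by move=> ys; rewrite inE ys orbT; split=> // yx; rewrite -yx ys in xs.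
Qed.

(** * The incidence set as a union of cycle spans, and its invariants *)

Section IncidenceSet.
Variables (R : realType) (G : digraph).
Local Notation N := #|edge G|.
Local Notation K := R[i].
Implicit Types (A B : {set dicycle G}).

Lemma incidence_set_delta (p : CP R N) : incidence_set G R p <->
  forall v, v \in val p -> v != 0 -> level_balanced v.
Proof.
split=> [pI v vp v0|pB f [n [a [g [gS ->]]]] v vp v0].
  apply/delta_level_balanced => u l ul; apply: pI => //.
  exists 1%N, (fun=> 1), (fun=> delta u l); split; first by move=> _; exists u, l.
  by rewrite big_ord1 mul1r.
rewrite (raddf_sum (map_mpoly intr)) (raddf_sum (meval _)) big1 // => i _ /=.
have [u [l [ul ->]]] := gS i.
rewrite rmorphM /= mevalM.
by have /delta_level_balanced -> := pB v vp v0; rewrite ?mulr0.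
Qed.

Lemma maximal_disjoint_extension A : edge_disjoint A ->
  exists2 B : {set dicycle G}, maxset (@edge_disjoint G) B & A \subset B.
Proof. by case/maxset_exists => B Bmax AB; exists B. Qed.

Definition maximal_collections : seq {set dicycle G} :=
  enum [set A : {set dicycle G} | maxset (@edge_disjoint G) A]%SET.

Lemma mem_maximal A : (A \in maximal_collections) = maxset (@edge_disjoint G) A.
Proof. by rewrite mem_enum inE. Qed.

Lemma maximal_disjoint A : A \in maximal_collections -> edge_disjoint A.
Proof. by rewrite mem_maximal => /maxsetp. Qed.

Definition maximal_spans := [seq cycle_span K A | A <- maximal_collections].

(** A point lies in the span of some edge-disjoint collection, and enlarging that collection to a
    maximal one only enlarges the span. *)
Lemma incidence_set_spans :
  incidence_set G R = \bigcup_(W in [set` maximal_spans]) linear_subspace W.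
Proof.
apply/seteqP; split=> p; have [v v0 pv] := point_gen p.
  move=> /incidence_set_delta pB.
  have [|A dA vA] := @level_balanced_cycle_span K G v; first by apply: pB; rewrite // pv memv_line.
  have [B Bmax AB] := maximal_disjoint_extension dA.
  have dB := maxsetp Bmax.
  exists (cycle_span K B); first by apply: map_f; rewrite mem_maximal.
  apply/(linear_subspace_line _ pv); apply: subvP vA.
  by rewrite cycle_span_sub.
move=> [_ /= /mapP[A /maximal_disjoint dA ->] pA].
apply/incidence_set_delta => w wp _; apply: (cycle_span_level_balanced dA).
exact: (subvP pA).
Qed.

Lemma maximal_spans_antichain (W W' : {vspace 'rV[K]_N}) : W \in maximal_spans ->
  W' \in maximal_spans -> (W <= W')%VS -> W = W'.
Proof.
move=> /mapP[A Am ->] /mapP[B Bm ->].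
have [dA dB] := (maximal_disjoint Am, maximal_disjoint Bm).
rewrite cycle_span_sub // => AB; congr cycle_span.
by move: Am; rewrite mem_maximal => /maxsetP[_ /(_ B dB AB)].
Qed.

Lemma maximal_spans_inj : {in maximal_collections &, injective (@cycle_span K G)}.
Proof.
move=> A B /maximal_disjoint dA /maximal_disjoint dB eAB.
by apply/eqP; rewrite finset.eqEsubset -!(cycle_span_sub K) // eAB subvv.
Qed.

Lemma card_le_alpha A : edge_disjoint A -> (#|A| <= alpha G)%N.
Proof.
by move=> dA; apply: (leq_bigmax_cond (F := fun A : {set dicycle G} => #|A|)).
Qed.

Lemma alpha_attained : exists2 A, A \in maximal_collections & #|A| = alpha G.
Proof.
have d0 : edge_disjoint (finset.set0 : {set dicycle G}).
  by apply/edge_disjointP => c d x; rewrite inE.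
have d_gt0 : (0 < #|@edge_disjoint G|)%N.
  by apply/card_gt0P; exists finset.set0.
have [A dA eA] := eq_bigmax_cond (fun A : {set dicycle G} => #|A|) d_gt0.
have [B Bmax AB] := maximal_disjoint_extension dA.
exists B; first by rewrite mem_maximal.
apply/eqP; rewrite eqn_leq; apply/andP; split.
  exact: card_le_alpha (maxsetp Bmax).
by rewrite /alpha eA subset_leq_card.
Qed.

Lemma proj_dim_incidence : proj_dim (incidence_set G R) = (alpha G)%:Z - 1.
Proof.
have [A Am eA] := alpha_attained; have dA := maximal_disjoint Am.
rewrite -eA -(dim_cycle_span K dA) incidence_set_spans.
apply: proj_dim_union; first exact: map_f.
move=> _ /mapP[B Bm ->]; have dB := maximal_disjoint Bm.
by rewrite !dim_cycle_span // eA card_le_alpha.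
Qed.

Definition components_of_card n : seq (set (CP R N)) :=
  [seq linear_subspace (cycle_span K A) | A <- maximal_collections & #|A| == n].

Lemma components_of_card_uniq n : uniq (components_of_card n).
Proof.
rewrite map_inj_in_uniq; first exact/filter_uniq/enum_uniq.
move=> A B; rewrite mem_filter => /andP[_ Am]; rewrite mem_filter => /andP[_ Bm].
by move/linear_subspace_inj/(maximal_spans_inj Am Bm).
Qed.

Lemma size_components_of_card n : size (components_of_card n) = gamma G n.
Proof.
have un : uniq [seq A : {set dicycle G} <- maximal_collections | #|A| == n].
  exact/filter_uniq/enum_uniq.
rewrite size_map -(card_uniqP un).
by apply: eq_card => A; rewrite mem_filter mem_maximal inE andbC.
Qed.

Lemma cycle_span_neq0 A : edge_disjoint A -> (cycle_span K A != 0%VS) = (#|A| != 0%N).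
Proof. by move=> dA; rewrite -dimv_eq0 dim_cycle_span. Qed.

Lemma components_incidence n : (0 < n)%N ->
  [set Z | component (incidence_set G R) Z /\ proj_dim Z = n%:Z - 1]
    = [set` components_of_card n].
Proof.
move=> n0; rewrite incidence_set_spans; apply/seteqP; split=> Z /=.
  move=> [/(component_union _ maximal_spans_antichain)[_ [/mapP[A Am ->] _] ->]].
  rewrite proj_dim_linear dim_cycle_span ?maximal_disjoint // => /addIr[An].
  by apply: map_f; rewrite mem_filter An eqxx.
move=> /mapP[A]; rewrite mem_filter => /andP[/eqP An Am] ->.
have dA := maximal_disjoint Am; split.
  apply/(component_union _ maximal_spans_antichain); exists (cycle_span K A) => //.
  by split; [exact: map_f|rewrite cycle_span_neq0 // An -lt0n].
by rewrite proj_dim_linear dim_cycle_span // An.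
Qed.

Lemma incidence_set_eq0 : (incidence_set G R = set0) <-> alpha G = 0%N.
Proof.
split=> [X0|a0].
  have [A Am <-] := alpha_attained; have dA := maximal_disjoint Am.
  apply/eqP; rewrite -[_ == _]negbK -cycle_span_neq0 //; apply/negP.
  move=> /linear_subspace_neq0[p pA]; suff : incidence_set G R p by rewrite X0.
  by rewrite incidence_set_spans; exists (cycle_span K A); first exact: map_f.
rewrite -subset0 incidence_set_spans => p [_ /= /mapP[A Am ->]].
have dA := maximal_disjoint Am; suff -> : cycle_span K A = 0%VS by rewrite linear_subspace0.
apply/eqP; rewrite -[_ == _]negbK cycle_span_neq0 // negbK -leqn0 -a0.
exact: card_le_alpha.
Qed.

(** Only the empty collection remains; this matches the degree 1 assigned to the empty projective
    set. *)
Lemma gamma_alpha0 : alpha G = 0%N -> gamma G 0 = 1%N.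
Proof.
move=> a0; have [A Am] := alpha_attained; rewrite a0 => /cards0_eq A0.
rewrite -(cards1 (finset.set0 : {set dicycle G})); apply: eq_card => B.
rewrite !inE cards_eq0; apply/andP/eqP => [[_ /eqP//]|->].
by rewrite -A0 -mem_maximal.
Qed.

(** Every top-dimensional component is linear and contributes 1, so the degree counts the maximal
    collections with [alpha G] cycles. *)
Lemma degree_incidence : degree (incidence_set G R) = gamma G (alpha G).
Proof.
rewrite /degree; case: pselect => [X0|X0] /=.
  by rewrite (incidence_set_eq0.1 X0) gamma_alpha0 //; apply: incidence_set_eq0.1.
have a_gt0 : (0 < alpha G)%N by rewrite lt0n; apply/eqP => /incidence_set_eq0.
rewrite proj_dim_incidence components_incidence //.
rewrite -fsbig_seq ?components_of_card_uniq // -size_components_of_card.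
rewrite -sum1_size; apply: eq_big_seq => Z /mapP[A].
rewrite mem_filter => /andP[/eqP An Am] ->; apply: degree_irr_linear.
by rewrite cycle_span_neq0 ?maximal_disjoint // An -lt0n.
Qed.

End IncidenceSet.

Theorem theorem1p3 (R : realType) (G : digraph) :
  [/\ exists s : seq {vspace 'rV[complex R]_#|edge G|},
        incidence_set G R = \bigcup_(W in [set` s]) linear_subspace W,
      proj_dim (incidence_set G R) = (alpha G)%:Z - 1,
      degree (incidence_set G R) = gamma G (alpha G) &
      forall n : nat, (1 <= n)%N ->
        ([set Z | component (incidence_set G R) Z /\ proj_dim Z = n%:Z - 1]
           #= `I_(gamma G n))%card].
Proof.
split.
- by exists (maximal_spans R G); apply: incidence_set_spans.
- exact: proj_dim_incidence.
- exact: degree_incidence.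
- move=> n n0; rewrite components_incidence // -(size_components_of_card R).
  exact: card_set_seq (components_of_card_uniq _ _ _).
Qed.
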